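(* Let $\mathcal{A}$ be a C*-algebra and let $E, F$ be Hilbert $\mathcal{A}$-modules. Then the space $B(E,F)$ of all bounded adjointable operators from $E$ to $F$ is an open dense subset of the space $R(E,F)$ of all regular operators from $E$ to $F$, where $R(E,F)$ carries the gap topology.
   Context: $\mathcal{A}$ is an arbitrary (not necessarily unital) C*-algebra. Hilbert $\mathcal{A}$-modules are left modules with $\mathcal{A}$-valued inner product that is $\mathcal{A}$-linear in the first variable. $B(E,F)$ is the set of $\mathcal{A}$-linear maps $T:E\to F$ for which there is $T^*:F\to E$ with $\langle Tx,y\rangle=\langle x,T^*y\rangle$ for all $x\in E$, $y\in F$. For an $\mathcal{A}$-linear operator $t:Dom(t)\subseteq E\to F$ with $Dom(t)$ a dense submodule, the adjoint $t^*$ has domain $Dom(t^* )=\{y\in F:\exists z\in E,\ \langle tx,y\rangle=\langle x,z\rangle\ \forall x\in Dom(t)\}$ and satisfies $t^*y=z$. Such $t$ is called regular if $t$ is closed (its graph $G(t)=\{(x,tx):x\in Dom(t)\}$ is closed in $E\oplus F$), $t^*$ is densely defined, and $1+t^*t$ has dense range in $E$. $R(E,F)$ denotes the set of regular operators; every $T\in B(E,F)$ is regular, so $B(E,F)\subseteq R(E,F)$. The graph of a regular operator is orthogonally complemented in $E\oplus F$; let $P_{G(t)}\in B(E\oplus F)$ be the orthogonal projection onto $G(t)$. The gap metric on $R(E,F)$ is $d(t,s)=\|P_{G(t)}-P_{G(s)}\|$, and the gap topology is the topology it induces. *)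

(* Defs.v *)
From HB Require Import structures.
From mathcomp Require Import all_boot all_order all_algebra.
From mathcomp Require Import complex.
From mathcomp Require Import all_classical all_reals all_analysis.

Set Implicit Arguments.
Unset Strict Implicit.
Unset Printing Implicit Defensive.

Import Order.TTheory GRing.Theory Num.Theory numFieldNormedType.Exports.

Local Open Scope classical_set_scope.
Local Open Scope ring_scope.

(* The library has no non-unital rings, so the multiplication of a C*-algebra
   is a bare operation on a complex Banach space.  There is no unit. *)
HB.mixin Record isCStarAlgebra (R : realType) A
    of CompleteNormedModule R[i] A := {
  cmul : A -> A -> A;
  cstar : A -> A;
  cmulA : forall a b c, cmul a (cmul b c) = cmul (cmul a b) c;
  cmulDl : forall a b c, cmul (a + b) c = cmul a c + cmul b c;
  cmulDr : forall a b c, cmul a (b + c) = cmul a b + cmul a c;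
  cmulZl : forall (k : R[i]) a b, cmul (k *: a) b = k *: cmul a b;
  cmulZr : forall (k : R[i]) a b, cmul a (k *: b) = k *: cmul a b;
  cstarK : forall a, cstar (cstar a) = a;
  cstarD : forall a b, cstar (a + b) = cstar a + cstar b;
  cstarZ : forall (k : R[i]) a, cstar (k *: a) = Num.conj k *: cstar a;
  cstarM : forall a b, cstar (cmul a b) = cmul (cstar b) (cstar a);
  cnormM : forall a b, `|cmul a b| <= `|a| * `|b|;
  cnorm_star : forall a, `|cmul (cstar a) a| = `|a| ^+ 2
}.

#[short(type="cstarAlgType")]
HB.structure Definition CStarAlgebra (R : realType) :=
  {A of CompleteNormedModule R[i] A & isCStarAlgebra R A}.

Definition cpositive (R : realType) (A : cstarAlgType R) (a : A) : Prop :=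
  exists b : A, a = cmul (cstar b) b.

(* Left modules, with inner product linear in the first variable.  The norm of
   the underlying Banach space is forced to be `|<x, x>| ^ (1/2) by [inner_norm],
   which also makes the inner product definite. *)
HB.mixin Record isHilbertModule (R : realType) (A : cstarAlgType R) E
    of CompleteNormedModule R[i] E := {
  act : A -> E -> E;
  inner : E -> E -> A;
  actA : forall (a b : A) (x : E), act a (act b x) = act (cmul a b) x;
  actDl : forall (a b : A) (x : E), act (a + b) x = act a x + act b x;
  actDr : forall (a : A) (x y : E), act a (x + y) = act a x + act a y;
  actZl : forall (k : R[i]) (a : A) (x : E), act (k *: a) x = k *: act a x;
  actZr : forall (k : R[i]) (a : A) (x : E), act a (k *: x) = k *: act a x;
  innerDl : forall x y z : E, inner (x + y) z = inner x z + inner y z;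
  innerZl : forall (k : R[i]) (x y : E), inner (k *: x) y = k *: inner x y;
  inner_act : forall (a : A) (x y : E), inner (act a x) y = cmul a (inner x y);
  inner_star : forall x y : E, cstar (inner x y) = inner y x;
  inner_ge0 : forall x : E, cpositive (inner x x);
  inner_norm : forall x : E, `|x| ^+ 2 = `|inner x x|
}.

#[short(type="hilbertModType")]
HB.structure Definition HilbertModule (R : realType) (A : cstarAlgType R) :=
  {E of CompleteNormedModule R[i] E & isHilbertModule R A E}.

Section Operators.
Variables (R : realType) (A : cstarAlgType R) (E F : hilbertModType A).

(* Densely defined A-linear operators.  The total function [op_app] is
   normalized to 0 outside the domain, so that two operators are equal exactly
   when they have the same domain and agree on it. *)
Record operator := Operator {
  op_dom : set E;
  op_app :> E -> F;
  op_dom0 : op_dom 0;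
  op_domD : forall x y, op_dom x -> op_dom y -> op_dom (x + y);
  op_domZ : forall (k : R[i]) x, op_dom x -> op_dom (k *: x);
  op_dom_act : forall (a : A) x, op_dom x -> op_dom (act a x);
  op_dom_dense : dense op_dom;
  op_appD : forall x y, op_dom x -> op_dom y ->
    op_app (x + y) = op_app x + op_app y;
  op_appZ : forall (k : R[i]) x, op_dom x -> op_app (k *: x) = k *: op_app x;
  op_app_act : forall (a : A) x, op_dom x -> op_app (act a x) = act a (op_app x);
  op_app_out : forall x, ~ op_dom x -> op_app x = 0
}.

Definition graph (t : operator) : set (E * F) :=
  [set z | op_dom t z.1 /\ z.2 = t z.1].

Definition adjoint_rel (t : operator) (y : F) (z : E) : Prop :=
  forall x, op_dom t x -> inner (t x) y = inner x z.

Definition adjoint_dom (t : operator) : set F :=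
  [set y | exists z, adjoint_rel t y z].

Definition adjoint (t : operator) (y : F) : E := xget 0 (adjoint_rel t y).

(* Closedness of the graph is taken in the product topology of E * F, which is
   the topology of the Hilbert module norm [sum_norm] below. *)
Definition regular : set operator :=
  [set t | [/\ closed (graph t),
               dense (adjoint_dom t) &
               dense ([set x + adjoint t (t x) | x in
                        [set x | op_dom t x /\ adjoint_dom t (t x)]] : set E)]].

Definition bounded_adjointable : set operator :=
  [set t | op_dom t = setT /\
           exists tstar : F -> E, forall x y, inner (t x) y = inner x (tstar y)].

(* The canonical norm of the product type E * F is the max norm; the norm of
   the Hilbert module direct sum is [sum_norm], and operators on the direct sum
   are measured with the latter. *)
Definition sum_inner (z w : E * F) : A := inner z.1 w.1 + inner z.2 w.2.

Definition sum_norm (z : E * F) : R := Num.sqrt (complex.Re `|sum_inner z z|).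

Definition op_norm (T : E * F -> E * F) : R :=
  sup [set sum_norm (T z) | z in [set z | sum_norm z <= 1]].

(* Self-adjointness makes P adjointable, hence A-linear. *)
Definition is_orth_proj (M : set (E * F)) (P : E * F -> E * F) : Prop :=
  [/\ forall z w, sum_inner (P z) w = sum_inner z (P w),
      forall z, P (P z) = P z &
      range P = M].

Definition graph_proj (t : operator) : E * F -> E * F :=
  xget (fun=> 0) (is_orth_proj (graph t)).

Definition gap (t s : operator) : R :=
  op_norm (fun z => graph_proj t z - graph_proj s z).

Record regular_op := RegularOp {
  regular_val :> operator;
  regular_valP : regular regular_val
}.

HB.instance Definition _ := gen_eqMixin regular_op.
HB.instance Definition _ := gen_choiceMixin regular_op.

Definition gap_open (U : set regular_op) : Prop :=
  forall t, U t -> exists2 e : R, 0 < e & forall s : regular_op, gap t s < e -> U s.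

Lemma gap_openT : gap_open setT.
Proof. by move=> t _; exists 1. Qed.

Lemma gap_openI (U V : set regular_op) :
  gap_open U -> gap_open V -> gap_open (U `&` V).
Proof.
move=> oU oV t [/oU[e e0 Ue] /oV[f f0 Vf]].
exists (Num.min e f); first by rewrite lt_min e0.
by move=> s; rewrite lt_min => /andP[/Ue ? /Vf].
Qed.

Lemma gap_open_bigU (I : Type) (f : I -> set regular_op) :
  (forall i, gap_open (f i)) -> gap_open (\bigcup_i f i).
Proof.
move=> of_ t [i _ /of_[e e0 fe]]; exists e => // s /fe fs.
by exists i.
Qed.

HB.instance Definition _ :=
  isOpenTopological.Build regular_op gap_openT gap_openI gap_open_bigU.

End Operators.

Arguments operator {R A} E F.
Arguments regular {R A} E F.
Arguments bounded_adjointable {R A} E F.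
Arguments regular_op {R A} E F.

(* Main.v *)
(* The order on a non-unital C*-algebra [A] is built from square roots of
   operators.  A self-adjoint [p] on a space with an [A]-valued inner product is
   called positive when [|r - p| <= r] for some [r >= 0]; such [p] form a cone,
   have square roots, and [|p| <= |p + q|].  Kaplansky's argument shows that
   [b^* b] is positive; the Cauchy-Schwarz inequality in Hilbert modules follows.

   For a regular [t] the operator [1 + t^* t] is onto, which splits [E + F] into
   the graph of [t] and its complement.  With [C = (1 + e t^* t)^(-1/2)], the
   operator [t C] is bounded and adjointable, and
   [|(1 - C) x|^2 <= <x, x> - <C x, C x> = e |t C x|^2] compares the points
   [(C x, t C x)] and [(x, t C x)] of the graphs of [t] and [t C], so the gap
   between [t] and [t C] is at most [2 sqrt e].  Openness follows from Neumann
   series. *)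
Require Import Defs.
From mathcomp Require Import all_boot all_order all_algebra.
From mathcomp Require Import complex.
From mathcomp Require Import all_classical all_reals all_analysis.
From mathcomp Require Import ring lra.

Set Implicit Arguments.
Unset Strict Implicit.
Unset Printing Implicit Defensive.

Import Order.TTheory GRing.Theory Num.Theory numFieldNormedType.Exports.

Local Open Scope classical_set_scope.
Local Open Scope ring_scope.
Local Open Scope complex_scope.

(** * Linear combinations and real-valued norms *)

(** Order statements are phrased as norm bounds on operators, not through spectra. [A] acts on
    itself by left multiplication, so that a scalar minus an element makes sense as an operator even
    when it is not an element of [A]. The root [C] of [D = (1 + e t^* t)^-1] is used instead of [D]
    because [1 - C^2 = e C t^* t C] controls [x - C x] by [t C x], whereas [x - D x = e t^* t D x]
    is not controlled by [t D x]. The points [(C x, t C x)] are not known in advance to exhaust the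
    graph of [t]. However, the range of [C] contains the domain of [t^* t], and vectors of [E + F]
    whose second component lies in the domain of [t^*] project to graph points over that domain,
    which suffices by density. Adjointable maps are not assumed bounded, so their boundedness has to
    be proved by a uniform boundedness argument. *)

Section LinearCombinations.
Variables (K : comNzRingType) (V : lmodType K).

Inductive lexp := LVar of nat | LZero | LAdd of lexp & lexp | LOpp of lexp
  | LScale of K & lexp.

Fixpoint leval (env : seq V) e : V :=
  match e with
  | LVar n => nth 0 env n
  | LZero => 0
  | LAdd a b => leval env a + leval env b
  | LOpp a => - leval env a
  | LScale k a => k *: leval env a
  end.

Fixpoint lcoef e (i : nat) : K :=
  match e with
  | LVar n => if eqn n i then 1 else 0
  | LZero => 0
  | LAdd a b => lcoef a i + lcoef b i
  | LOpp a => - lcoef a i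
  | LScale k a => k * lcoef a i
  end.

Lemma levalE env e : leval env e = \sum_(i < size env) lcoef e i *: nth 0 env i.
Proof.
elim: e => /= [n||a -> b ->|a ->|k a ->].
- have [le_n|lt_n] := leqP (size env) n.
    rewrite nth_default// big1// => i _.
    case: eqnP => [eni|]; last by rewrite scale0r.
    by have := ltn_ord i; rewrite -eni ltnNge le_n.
  rewrite (bigD1 (Ordinal lt_n))//= (introT eqnP erefl) scale1r big1 ?addr0// => i ni.
  case: eqnP => [eni|]; last by rewrite scale0r.
  by move: ni; rewrite -val_eqE /= eni eqxx.
- by rewrite big1// => i _; rewrite scale0r.
- by rewrite -big_split/=; apply: eq_bigr => i _; rewrite scalerDl.
- by rewrite -sumrN; apply: eq_bigr => i _; rewrite scaleNr.
- by rewrite scaler_sumr; apply: eq_bigr => i _; rewrite scalerA.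
Qed.

(** A conjunction computed by recursion instead of a bounded quantifier, so that [cbn] unfolds it
    into one scalar goal per atom. *)
Fixpoint lcoef_eq (n : nat) (a b : lexp) : Prop :=
  if n is n'.+1 then lcoef a n' = lcoef b n' /\ lcoef_eq n' a b else True.

Lemma leval_eq env a b : lcoef_eq (size env) a b -> leval env a = leval env b.
Proof.
rewrite !levalE => ab; apply: eq_bigr => -[i /= ilt] _; congr (_ *: _).
elim: (size env) ab ilt => // n IHn [eqn /IHn{}IHn].
by rewrite ltnS leq_eqVlt => /orP[/eqP-> //|/IHn].
Qed.

End LinearCombinations.

Ltac lin_mem x l :=
  match l with
  | nil => constr:(false)
  | x :: _ => constr:(true)
  | _ :: ?l' => lin_mem x l'
  end.

Ltac lin_index x l :=
  match l with
  | x :: _ => constr:(0%N)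
  | _ :: ?l' => let n := lin_index x l' in constr:(S n)
  end.

Ltac lin_atoms l e :=
  lazymatch e with
  | ?a + ?b => let l' := lin_atoms l a in lin_atoms l' b
  | - ?a => lin_atoms l a
  | _ *: ?a => lin_atoms l a
  | 0 => constr:(l)
  | _ => let b := lin_mem e l in
         lazymatch b with true => constr:(l) | false => constr:(e :: l) end
  end.

Ltac lin_reify K l e :=
  lazymatch e with
  | ?a + ?b => let a' := lin_reify K l a in let b' := lin_reify K l b in
               constr:(LAdd a' b')
  | - ?a => let a' := lin_reify K l a in constr:(LOpp a')
  | ?k *: ?a => let a' := lin_reify K l a in constr:(LScale k a')
  | 0 => constr:(LZero K)
  | _ => let n := lin_index e l in constr:(LVar K n)
  end.

(* Proves an identity between linear combinations over the scalar ring [K] by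
   comparing the coefficients of the atoms. *)
Ltac lin_eq K :=
  rewrite ?mulr2n;
  lazymatch goal with
  | |- @eq ?V ?a ?b =>
    let l := lin_atoms (@nil V) a in
    let l := lin_atoms l b in
    let ea := lin_reify K l a in
    let eb := lin_reify K l b in
    apply: (@leval_eq _ _ l ea eb);
    cbn [lcoef_eq lcoef size eqn]; repeat split; try ring; try by field
  end.

Section RealNorm.
Variables (R : realType).

(** Norms are [R[i]]-valued; passing to [R] makes estimates accessible to [lra] and [nra]. *)
Definition nrm (V : normedModType R[i]) (x : V) : R := complex.Re `|x|.

Lemma nrmE (V : normedModType R[i]) (x : V) : `|x| = (nrm x)%:C.
Proof. by rewrite /nrm RRe_real ?normr_real. Qed.

End RealNorm.

Section RealNormTheory.
Variables (R : realType) (V : normedModType R[i]).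
Implicit Types (x y : V) (r : R).

Lemma nrm_ge0 x : 0 <= nrm x.
Proof. by rewrite -ler0c -nrmE. Qed.

Lemma nrmD x y : nrm (x + y) <= nrm x + nrm y.
Proof. by rewrite -lecR rmorphD /= -!nrmE ler_normD. Qed.

Lemma nrmN x : nrm (- x) = nrm x.
Proof. by rewrite /nrm normrN. Qed.

Lemma nrmB x y : nrm (x - y) <= nrm x + nrm y.
Proof. by rewrite (le_trans (nrmD _ _))// nrmN. Qed.

Lemma nrmC x y : nrm (x - y) = nrm (y - x).
Proof. by rewrite -nrmN opprB. Qed.

Lemma nrm0 : nrm (0 : V) = 0.
Proof. by rewrite /nrm normr0. Qed.

Lemma nrm_eq0 x : nrm x = 0 -> x = 0.
Proof. by move=> x0; apply/normr0_eq0; rewrite nrmE x0. Qed.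

Lemma nrmZ r x : nrm (r%:C *: x) = `|r| * nrm x.
Proof.
apply: complexI; rewrite -nrmE normrZ nrmE rmorphM /=; congr (_ * _).
by rewrite normc_def /= expr0n addr0 sqrtr_sqr.
Qed.

Lemma nrmZp r x : 0 <= r -> nrm (r%:C *: x) = r * nrm x.
Proof. by move=> r0; rewrite nrmZ ger0_norm. Qed.

Lemma nrm_i x : nrm ('i *: x) = nrm x.
Proof. by rewrite /nrm normrZ normc_def /= expr0n expr1n add0r sqrtr1 mul1r. Qed.

Lemma nrm_dist3 x y z : nrm (x - z) <= nrm (x - y) + nrm (y - z).
Proof.
have -> : x - z = (x - y) + (y - z) by lin_eq R[i].
exact: nrmD.
Qed.

Lemma nrm_small x : (forall e : R, 0 < e -> nrm x <= e) -> x = 0.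
Proof.
move=> xe; apply: nrm_eq0; apply/le_anti; rewrite nrm_ge0 andbT.
by apply/ler_addgt0Pl => e e0; rewrite addr0 xe.
Qed.

Definition lim_to (u : nat -> V) x :=
  forall e : R, 0 < e -> exists N, forall n, (N <= n)%N -> nrm (u n - x) <= e.

Lemma lim_to_uniq u x y : lim_to u x -> lim_to u y -> x = y.
Proof.
move=> ux uy; apply/subr0_eq/nrm_small => e e0.
have e2 : 0 < e / 2 by lra.
have [N uN] := ux _ e2; have [M uM] := uy _ e2.
have := nrm_dist3 x (u (N + M)%N) y.
have := uN _ (leq_addr M N); have := uM _ (leq_addl N M).
by rewrite (nrmC x (u _)); lra.
Qed.

Lemma lim_toD u v x y : lim_to u x -> lim_to v y ->
  lim_to (fun n => u n + v n) (x + y).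
Proof.
move=> ux vy e e0; have e2 : 0 < e / 2 by lra.
have [N uN] := ux _ e2; have [M vM] := vy _ e2.
exists (N + M)%N => n le_n.
have := uN _ (leq_trans (leq_addr M N) le_n).
have := vM _ (leq_trans (leq_addl N M) le_n).
have := nrmD (u n - x) (v n - y).
have -> : u n - x + (v n - y) = u n + v n - (x + y) by lin_eq R[i].
lra.
Qed.

Lemma lim_to_cst x : lim_to (fun=> x) x.
Proof. by move=> e e0; exists 0%N => n _; rewrite subrr nrm0 ltW. Qed.

Lemma lim_to_shift u x : lim_to u x -> lim_to (fun n => u n.+1) x.
Proof.
by move=> ux e /ux[N uN]; exists N => n le_n; rewrite uN ?leqW.
Qed.

Lemma lim_to_nrm_le u x r : lim_to u x -> (forall n, nrm (u n) <= r) -> nrm x <= r.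
Proof.
move=> ux ur; apply/ler_addgt0Pl => e e0; have [N uN] := ux _ e0.
have := uN _ (leqnn N); have := ur N; have := nrmB (u N) (u N - x).
have -> : u N - (u N - x) = x by lin_eq R[i].
lra.
Qed.

End RealNormTheory.

Lemma lim_to_map (R : realType) (V W : normedModType R[i]) (f : V -> W) (M : R)
    (u : nat -> V) (x : V) :
  {morph f : a b / a + b} -> (forall a, nrm (f a) <= M * nrm a) -> lim_to u x ->
  lim_to (fun n => f (u n)) (f x).
Proof.
move=> fD fM ux e e0; have M0 : 0 < `|M| + 1 by rewrite ltr_wpDl.
have [N uN] := ux _ (divr_gt0 e0 M0); exists N => n le_n.
have f0 : f 0 = 0 by apply: (addrI (f 0)); rewrite -fD !addr0.
have fN a : f (- a) = - f a by apply: (addrI (f a)); rewrite -fD !subrr.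
rewrite -fN -fD (le_trans (fM _))// (le_trans (_ : _ <= (`|M| + 1) * nrm (u n - x)))//.
  by rewrite ler_wpM2r ?nrm_ge0// (le_trans (ler_norm M))// lerDl.
by rewrite mulrC -ler_pdivlMr ?uN.
Qed.

(** * Convergence and Neumann series in Banach spaces *)

Section Complete.
Variables (R : realType) (V : completeNormedModType R[i]).

Lemma cauchy_lim_to (u : nat -> V) :
  (forall e : R, 0 < e ->
    exists N, forall n m, (N <= n)%N -> (N <= m)%N -> nrm (u n - u m) <= e) ->
  exists x, lim_to u x.
Proof.
move=> cu; have /cauchy_cvgP cv : cauchy (u @ \oo).
  apply/cauchy_ballP => e e0.
  have [d dE] : exists d, e = d%:C.
    by exists (complex.Re e); rewrite RRe_real// gtr0_real.
  move: e0; rewrite {e}dE ltcR => d0.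
  have d2 : 0 < d / 2 by lra.
  have [N uN] := cu _ d2.
  exists ([set u n | n in [set n | (N <= n)%N]],
          [set u n | n in [set n | (N <= n)%N]]).
    split; exists N => // n le_n /=; by exists n.
  move=> [a b] /= [[n Nn <-] [m Nm <-]].
  rewrite -ball_normE /= nrmE ltcR (le_lt_trans (uN _ _ Nn Nm))//; lra.
exists (lim (u @ \oo)) => e e0.
have e1 : (0 : R[i]) < e%:C by rewrite ltcR.
have /cvgrPdist_lt/(_ _ e1)[N _ uN] := cv.
by exists N => n /uN /=; rewrite nrmE ltcR nrmC => /ltW.
Qed.

Lemma geometric_small (q c e : R) : 0 <= q < 1 -> 0 <= c -> 0 < e ->
  exists N, forall n, (N <= n)%N -> c * q ^+ n <= e.
Proof.
move=> /andP[q0 q1] c0 e0.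
have q1' : `|q| < 1 by rewrite ger0_norm.
have : (fun n => c * q ^+ n) @ \oo --> c * 0.
  by apply: cvgMr; exact: cvg_expr.
rewrite mulr0 => /cvgrPdist_lt/(_ _ e0)[N _ uN]; exists N => n /uN /=.
by rewrite sub0r normrN => /(le_lt_trans (ler_norm _))/ltW.
Qed.

(** Telescoping bounds [u (n + k) - u n] by [a (n + k) - a n], and the nondecreasing bounded
    sequence [a] is eventually close to its supremum. *)
Lemma dominated_lim (u : nat -> V) (a : nat -> R) (B : R) :
  (forall n, nrm (u n.+1 - u n) <= a n.+1 - a n) -> (forall n, a n <= B) ->
  exists2 x, lim_to u x & forall n, nrm (x - u n) <= B - a n.
Proof.
move=> ua aB.
have dist n k : nrm (u (n + k)%N - u n) <= a (n + k)%N - a n.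
  elim: k => [|k IH]; first by rewrite addn0 !subrr nrm0.
  have := nrm_dist3 (u (n + k.+1)%N) (u (n + k)%N) (u n).
  have := ua (n + k)%N; rewrite !addnS; lra.
suff [x ux] : exists x, lim_to u x.
  exists x => // n; apply: (@lim_to_nrm_le _ _ (fun k => u (n + k)%N - u n)).
    apply: lim_toD; last exact: lim_to_cst.
    by move=> e /ux[N uN]; exists N => k le_k; rewrite uN// (leq_trans le_k)// leq_addl.
  by move=> k; rewrite (le_trans (dist n k))// lerD2r.
apply: cauchy_lim_to => e e0; have e2 : 0 < e / 2 by lra.
have a_sup : has_sup (range a).
  by split; [exists (a 0%N), 0%N|exists B => _ [n _ <-]].
have [_ [N _ <-] aN] := sup_adherent e2 a_sup.
have aS n : (N <= n)%N -> nrm (u n - u N) <= e / 2.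
  move=> le_n; rewrite -(subnKC le_n); apply: (le_trans (dist _ _)).
  have : a (N + (n - N))%N <= sup (range a).
    by apply: ub_le_sup; [exact: a_sup.2|exists (N + (n - N))%N].
  lra.
exists N => n m /aS un /aS um; have := nrm_dist3 (u n) (u N) (u m).
rewrite (nrmC (u N)); lra.
Qed.

Lemma neumann (S : V -> V) (q : R) : 0 <= q < 1 ->
  {morph S : a b / a + b} -> (forall x, nrm (S x) <= q * nrm x) ->
  forall z, exists x, z = x - S x.
Proof.
move=> q01 SD Sq z; have /andP[q0 q1] := q01.
have S0 : S 0 = 0 by apply: (addrI (S 0)); rewrite -SD !addr0.
have SN a : S (- a) = - S a by apply: (addrI (S a)); rewrite -SD !subrr.
pose u n := iter n (fun x => z + S x) 0.
have du n : nrm (u n.+1 - u n) <= q ^+ n * nrm z.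
  elim: n => [|n IH]; first by rewrite /= S0 addr0 subr0 mul1r.
  have -> : u n.+2 - u n.+1 = S (u n.+1 - u n).
    by rewrite SD SN /u /=; lin_eq R[i].
  by rewrite (le_trans (Sq _))// exprS -mulrA ler_wpM2l.
have q1' : 0 < 1 - q by lra.
(* Minus the tail of the geometric series: its increments are [q ^+ n * nrm z], and it is bounded
   above by 0. *)
pose a n := - (q ^+ n * nrm z / (1 - q)).
have [x ux _] : exists2 x, lim_to u x & forall n, nrm (x - u n) <= 0 - a n.
  apply: dominated_lim => n.
    rewrite (le_trans (du n))// /a exprS le_eqVlt; apply/orP; left.
    by apply/eqP; field; rewrite gt_eqF.
  by rewrite /a oppr_le0 divr_ge0 ?mulr_ge0 ?exprn_ge0 ?nrm_ge0// ltW.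
exists x; have : lim_to (fun n => u n.+1) (z + S x).
  by apply: lim_toD; [exact: lim_to_cst|exact: (lim_to_map SD Sq)].
move=> /(lim_to_uniq (lim_to_shift ux)) xE; rewrite {1}xE; lin_eq R[i].
Qed.

End Complete.

(** * Positivity in C*-algebras *)

Section CStarTheory.
Variables (R : realType) (A : cstarAlgType R).
Implicit Types (a b : A) (k : R[i]) (r : R).

Lemma cstar0 : cstar (0 : A) = 0.
Proof. by apply: (addrI (cstar (0 : A))); rewrite -cstarD !addr0. Qed.

Lemma cstarN a : cstar (- a) = - cstar a.
Proof. by apply: (addrI (cstar a)); rewrite -cstarD !subrr cstar0. Qed.

Lemma cmul0l a : cmul 0 a = 0.
Proof. by apply: (addrI (cmul 0 a)); rewrite -cmulDl !addr0. Qed.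

Lemma cmul0r a : cmul a 0 = 0.
Proof. by apply: (addrI (cmul a 0)); rewrite -cmulDr !addr0. Qed.

Lemma cmulNl a b : cmul (- a) b = - cmul a b.
Proof. by apply: (addrI (cmul a b)); rewrite -cmulDl !subrr cmul0l. Qed.

Lemma cmulNr a b : cmul a (- b) = - cmul a b.
Proof. by apply: (addrI (cmul a b)); rewrite -cmulDr !subrr cmul0r. Qed.

Lemma conj_realC r : Num.conj (r%:C) = r%:C.
Proof. by apply/CrealP; rewrite complex_real. Qed.

Lemma nrm_cmul a b : nrm (cmul a b) <= nrm a * nrm b.
Proof. by rewrite -lecR rmorphM /= -!nrmE cnormM. Qed.

Lemma nrm_starM a : nrm (cmul (cstar a) a) = nrm a ^+ 2.
Proof. by apply: complexI; rewrite rmorphXn /= -!nrmE cnorm_star. Qed.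

Lemma nrm_cstar a : nrm (cstar a) = nrm a.
Proof.
suff le b : nrm b <= nrm (cstar b).
  by apply/le_anti; rewrite le andbT -{2}(cstarK a) le.
have [->|b0] := eqVneq (nrm b) 0; first exact: nrm_ge0.
rewrite -(@ler_pM2r _ (nrm b)); last by rewrite lt_neqAle eq_sym b0 nrm_ge0.
by rewrite -expr2 -nrm_starM nrm_cmul.
Qed.

End CStarTheory.

Section IpSpace.
Variables (R : realType) (A : cstarAlgType R).

(* The Cauchy-Schwarz inequality is a field here, because the positivity theory
   of [A], from which it follows in Hilbert modules, is itself derived by
   viewing [A] as such a space. *)
Record ipSpace := IpSpace {
  ip_car :> completeNormedModType R[i];
  ip : ip_car -> ip_car -> A;
  ipDl : forall x y z, ip (x + y) z = ip x z + ip y z;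
  ipZl : forall (k : R[i]) x y, ip (k *: x) y = k *: ip x y;
  ip_star : forall x y, cstar (ip x y) = ip y x;
  ip_norm : forall x, nrm (ip x x) = nrm x ^+ 2;
  ip_cs : forall x y, nrm (ip x y) <= nrm x * nrm y
}.

Variable X : ipSpace.
Implicit Types (x y z : X) (T S V : X -> X) (r : R).

Lemma ipDr x y z : ip x (y + z) = ip x y + ip x z.
Proof. by rewrite -ip_star ipDl cstarD !ip_star. Qed.

Lemma ip0l x : ip 0 x = 0.
Proof. by apply: (addrI (ip 0 x)); rewrite -ipDl !addr0. Qed.

Lemma ip0r x : ip x 0 = 0.
Proof. by rewrite -ip_star ip0l cstar0. Qed.

Lemma ip_eq0 x : ip x x = 0 -> x = 0.
Proof.
by move=> xx; apply/nrm_eq0/eqP; rewrite -sqrf_eq0 -ip_norm xx nrm0.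
Qed.

Lemma ipNl x y : ip (- x) y = - ip x y.
Proof. by apply: (addrI (ip x y)); rewrite -ipDl !subrr ip0l. Qed.

Lemma ipNr x y : ip x (- y) = - ip x y.
Proof. by rewrite -ip_star ipNl cstarN ip_star. Qed.

Lemma ipZr r x y : ip x (r%:C *: y) = r%:C *: ip x y.
Proof. by rewrite -ip_star ipZl cstarZ ip_star conj_realC. Qed.

Lemma ip_inj x y : (forall z, ip x z = ip y z) -> x = y.
Proof.
move=> xy; apply/subr0_eq/nrm_eq0/eqP; rewrite -sqrf_eq0 -ip_norm.
by rewrite ipDl ipNl xy subrr nrm0.
Qed.

(** [T] and [S] are bare functions; their linearity follows from adjointness through [ip_inj]. *)
Definition adj T S := forall x y, ip (T x) y = ip x (S y).
Definition bnd T r := forall x, nrm (T x) <= r * nrm x.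

Lemma adjC T S : adj T S -> adj S T.
Proof. by move=> TS x y; rewrite -ip_star -TS ip_star. Qed.

Lemma adj_comp T S T' S' : adj T S -> adj T' S' -> adj (T \o T') (S' \o S).
Proof. by move=> TS TS' x y /=; rewrite TS TS'. Qed.

Lemma adjD T S T' S' : adj T S -> adj T' S' ->
  adj (fun x => T x + T' x) (fun x => S x + S' x).
Proof. by move=> TS TS' x y /=; rewrite ipDl ipDr TS TS'. Qed.

Lemma adjB T S T' S' : adj T S -> adj T' S' ->
  adj (fun x => T x - T' x) (fun x => S x - S' x).
Proof. by move=> TS TS' x y /=; rewrite ipDl ipDr ipNl ipNr TS TS'. Qed.

Lemma adjZ r T S : adj T S -> adj (fun x => r%:C *: T x) (fun x => r%:C *: S x).
Proof. by move=> TS x y /=; rewrite ipZl ipZr TS. Qed.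

Lemma adj_scal r : adj (fun x => r%:C *: x) (fun x => r%:C *: x).
Proof. by move=> x y; rewrite ipZl ipZr. Qed.

Lemma adj_id : adj id id. Proof. by []. Qed.

Section AdjLinear.
Variables (T S : X -> X).
Hypothesis TS : adj T S.

Lemma adj_add x y : T (x + y) = T x + T y.
Proof. by apply: ip_inj => z; rewrite TS !ipDl !TS. Qed.

Lemma adj_scale (k : R[i]) x : T (k *: x) = k *: T x.
Proof. by apply: ip_inj => z; rewrite TS !ipZl !TS. Qed.

Lemma adj_opp x : T (- x) = - T x.
Proof. by rewrite -scaleN1r adj_scale scaleN1r. Qed.

Lemma adj0 : T 0 = 0.
Proof. by apply: (addrI (T 0)); rewrite -adj_add !addr0. Qed.

Lemma adj_sub x y : T (x - y) = T x - T y.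
Proof. by rewrite adj_add adj_opp. Qed.

(** The C*-identity for operators: [|T x|^2 = |<x, S (T x)>|]. *)
Lemma bnd_cstar r : 0 <= r -> bnd (S \o T) (r ^+ 2) -> bnd T r.
Proof.
move=> r0 ST x; rewrite -(@ler_pXn2r _ 2)// ?nnegrE ?mulr_ge0 ?nrm_ge0//.
rewrite -ip_norm TS (le_trans (ip_cs _ _))// exprMn mulrC expr2 mulrA.
by rewrite ler_wpM2r ?nrm_ge0// ST.
Qed.

Lemma bnd_adj r : 0 <= r -> bnd T r -> bnd S r.
Proof.
move=> r0 bT x; have [->|Sx0] := eqVneq (nrm (S x)) 0.
  by rewrite mulr_ge0 ?nrm_ge0.
rewrite -(@ler_pM2l _ (nrm (S x))); last by rewrite lt_neqAle eq_sym Sx0 nrm_ge0.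
rewrite -expr2 -ip_norm -TS (le_trans (ip_cs _ _))// mulrA [_ * r]mulrC.
by rewrite ler_wpM2r ?nrm_ge0// bT.
Qed.

End AdjLinear.

Lemma bnd_comp T S r r' : 0 <= r -> bnd T r -> bnd S r' -> bnd (T \o S) (r * r').
Proof. by move=> r0 bT bS x; rewrite (le_trans (bT _))// -mulrA ler_wpM2l. Qed.

Lemma bndD T S r r' : bnd T r -> bnd S r' -> bnd (fun x => T x + S x) (r + r').
Proof. by move=> bT bS x; rewrite (le_trans (nrmD _ _))// mulrDl lerD. Qed.

Lemma bndB T S r r' : bnd T r -> bnd S r' -> bnd (fun x => T x - S x) (r + r').
Proof. by move=> bT bS x; rewrite (le_trans (nrmB _ _))// mulrDl lerD. Qed.

Lemma bndZ T r r' : 0 <= r' -> bnd T r -> bnd (fun x => r'%:C *: T x) (r' * r).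
Proof. by move=> r0 bT x; rewrite nrmZp// -mulrA ler_wpM2l. Qed.

Lemma bnd_le T r r' : r <= r' -> bnd T r -> bnd T r'.
Proof. by move=> le_r bT x; rewrite (le_trans (bT _))// ler_wpM2r ?nrm_ge0. Qed.

Definition sym T := adj T T.

(** * Square roots by monotone iteration *)

Section SquareRoot.
Variable T : X -> X.
Hypotheses (symT : sym T) (bndT : bnd T 1).

Let half : R[i] := (2^-1 : R)%:C.

(* [Y = lim Y_n] satisfies [2 Y = T + Y^2], that is [(1 - Y)^2 = 1 - T].  The
   increments of [Y_n] are dominated by those of the scalar iteration [y_n]
   for [T = 1]. *)
Fixpoint sqrt_iter n : X -> X :=
  if n is n'.+1 then fun x => half *: (T x + sqrt_iter n' (sqrt_iter n' x))
  else fun=> 0.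

Fixpoint sqrt_bound n : R :=
  if n is n'.+1 then (1 + sqrt_bound n' ^+ 2) / 2 else 0.

Lemma sqrt_bound01 n : 0 <= sqrt_bound n <= 1.
Proof. by elim: n => [|n IH] /=; [lra|nra]. Qed.

Lemma sqrt_iter_sym n : sym (sqrt_iter n).
Proof.
elim: n => [|n IH] x y /=; first by rewrite ip0l -ip_star ip0l cstar0.
by rewrite ipZl ipZr !ipDl !ipDr symT !IH.
Qed.

Lemma sqrt_iter_bnd n : bnd (sqrt_iter n) (sqrt_bound n).
Proof.
elim: n => [|n IH] x /=; first by rewrite nrm0 mul0r.
have /andP[y0 y1] := sqrt_bound01 n.
rewrite nrmZp ?invr_ge0// mulrC -mulrA [_^-1 * _]mulrC mulrA.
rewrite ler_wpM2r ?invr_ge0// (le_trans (nrmD _ _))// mulrDl lerD//.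
by rewrite expr2; apply: (bnd_comp y0 IH IH).
Qed.

Lemma sqrt_iter_step n :
  bnd (fun x => sqrt_iter n.+1 x - sqrt_iter n x) (sqrt_bound n.+1 - sqrt_bound n).
Proof.
elim: n => [|n IH] x.
  rewrite /= addr0 !subr0 expr0n addr0 mul1r.
  by rewrite nrmZp ?invr_ge0// ler_wpM2l ?invr_ge0// -[leRHS]mul1r.
set Yn := sqrt_iter n in IH *; set Ym := sqrt_iter n.+1 in IH *.
(* This splitting of [Ym^2 - Yn^2] uses no commutation, and the scalar iteration satisfies the same
   identity. *)
have -> : sqrt_iter n.+2 x - Ym x = half *: (Ym (Ym x - Yn x) + (Ym (Yn x) - Yn (Yn x))).
  rewrite (adj_sub (@sqrt_iter_sym n.+1 : sym Ym)).
  have -> : Ym (Ym x) - Ym (Yn x) + (Ym (Yn x) - Yn (Yn x)) =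
    (T x + Ym (Ym x)) - (T x + Yn (Yn x)) by lin_eq R[i].
  by rewrite scalerBr.
have /andP[yn0 yn1] := sqrt_bound01 n; have /andP[ym0 ym1] := sqrt_bound01 n.+1.
have -> : sqrt_bound n.+2 - sqrt_bound n.+1 =
  2^-1 * (sqrt_bound n.+1 * (sqrt_bound n.+1 - sqrt_bound n) +
          (sqrt_bound n.+1 - sqrt_bound n) * sqrt_bound n).
  have : sqrt_bound n.+1 = (1 + sqrt_bound n ^+ 2) / 2 by [].
  have -> : sqrt_bound n.+2 = (1 + sqrt_bound n.+1 ^+ 2) / 2 by [].
  by lra.
have d0 : 0 <= sqrt_bound n.+1 - sqrt_bound n by rewrite /=; nra.
rewrite nrmZp ?invr_ge0// -mulrA ler_wpM2l ?invr_ge0//.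
rewrite (le_trans (nrmD _ _))// mulrDl lerD//.
  exact: (bnd_comp ym0 (@sqrt_iter_bnd n.+1) IH).
exact: (bnd_comp d0 IH (@sqrt_iter_bnd n)).
Qed.

(** The bound on [1 - b] is what makes [b] positive in the sense of [spos]. Commutation holds for
    each iterate, a polynomial in [T], and passes to the limit because [V] is bounded. *)
Lemma sqrt_ex : exists b : X -> X,
  [/\ sym b, forall x, b (b x) = x - T x, bnd (fun x => x - b x) 1 &
    forall V r, (forall x y, V (x + y) = V x + V y) ->
      (forall k x, V (k *: x) = k *: V x) -> bnd V r ->
      (forall x, V (T x) = T (V x)) -> forall x, V (b x) = b (V x)].
Proof.
have cvY x : exists y, lim_to (fun n => sqrt_iter n x) y.
  have [|n|y ? _] := @dominated_lim _ X (fun n => sqrt_iter n x)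
      (fun n => sqrt_bound n * nrm x) (nrm x); last by exists y.
    by move=> n; rewrite -mulrBl sqrt_iter_step.
  by have := sqrt_bound01 n; have := nrm_ge0 x; nra.
have [Y limY] := choice cvY.
have bY : bnd Y 1.
  move=> x; apply: (lim_to_nrm_le (limY x)) => n; apply: (le_trans (sqrt_iter_bnd _ _)).
  by have := sqrt_bound01 n; have := nrm_ge0 x; nra.
have symY : sym Y.
  move=> x y; apply: (@lim_to_uniq _ _ (fun n => ip (sqrt_iter n x) y)).
    apply: (@lim_to_map _ _ _ (fun u : X => ip u y) (nrm y)) => // [a b|a].
      by rewrite ipDl.
    by rewrite mulrC ip_cs.
  under [X in lim_to X _]funext do rewrite sqrt_iter_sym.
  by apply: (@lim_to_map _ _ _ (fun u : X => ip x u) (nrm x)) => // [a b|a];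
    rewrite ?ipDr ?ip_cs.
(* With [Y_n] the iterates, the error is [Y_n (Y_n x - Y x) + (Y_n (Y x) - Y (Y x))], and the [Y_n]
   are contractions. *)
have limYY x : lim_to (fun n => sqrt_iter n (sqrt_iter n x)) (Y (Y x)).
  move=> e e0; have e2 : 0 < e / 2 by lra.
  have [N YN] := limY x _ e2; have [M YM] := limY (Y x) _ e2.
  exists (N + M)%N => n le_n.
  have := YN _ (leq_trans (leq_addr M N) le_n).
  have := YM _ (leq_trans (leq_addl N M) le_n).
  have := nrm_dist3 (sqrt_iter n (sqrt_iter n x)) (sqrt_iter n (Y x)) (Y (Y x)).
  rewrite -(adj_sub (@sqrt_iter_sym n)).
  have := sqrt_iter_bnd n (sqrt_iter n x - Y x).
  have := sqrt_bound01 n; have := nrm_ge0 (sqrt_iter n x - Y x); nra.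
have YE x : Y x = half *: (T x + Y (Y x)).
  apply: (lim_to_uniq (lim_to_shift (limY x))) => /=.
  apply: (@lim_to_map _ _ _ (fun u : X => half *: u) 2^-1) => [a b|a|].
  - by rewrite scalerDr.
  - by rewrite nrmZp ?invr_ge0.
  - by apply: lim_toD; [exact: lim_to_cst|exact: limYY].
exists (fun x => x - Y x); split.
- exact: adjB.
- move=> x; rewrite (adj_sub symY).
  have {}YE : T x = Y x + Y x - Y (Y x).
    have h2 : (2^-1 + 2^-1 : R) = 1 by lra.
    by rewrite {1 2}YE -scalerDl -rmorphD h2 rmorph1 scale1r addrK.
  by rewrite YE; lin_eq R[i].
- by move=> x; have -> : x - (x - Y x) = Y x by lin_eq R[i].
- move=> V r VD VZ bV VT x.
  have VN y : V (- y) = - V y by rewrite -scaleN1r VZ scaleN1r.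
  rewrite VD VN; congr (_ - _).
  have VY n y : V (sqrt_iter n y) = sqrt_iter n (V y).
    elim: n y => [|n IH] y /=; first by apply: (addrI (V 0)); rewrite -VD !addr0.
    by rewrite VZ VD VT !IH.
  apply: (@lim_to_uniq _ _ (fun n => V (sqrt_iter n x))).
    exact: (lim_to_map VD bV).
  by under [X in lim_to X _]funext do rewrite VY; exact: limY.
Qed.

End SquareRoot.

End IpSpace.

(** * The cone of positive operators *)

Section PositiveOperators.
Variables (R : realType) (A : cstarAlgType R) (X : ipSpace A).
Implicit Types (x y : X) (p q k m l S T V : X -> X) (r N : R).

(* Positivity in a form that is visibly stable under sums. *)
Definition spos p := sym p /\
  exists2 r, 0 <= r & bnd (fun x => r%:C *: x - p x) r.

Lemma bnd_shift p r r' : r <= r' ->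
  bnd (fun x => r%:C *: x - p x) r -> bnd (fun x => r'%:C *: x - p x) r'.
Proof.
move=> le_r bp x.
have -> : r'%:C *: x - p x = (r' - r)%:C *: x + (r%:C *: x - p x).
  by rewrite rmorphB /=; lin_eq R[i].
rewrite (le_trans (nrmD _ _))// nrmZp ?subr_ge0//.
by have := bp x; rewrite mulrBl; lra.
Qed.

Lemma sposD p q : spos p -> spos q -> spos (fun x => p x + q x).
Proof.
move=> [symp [r r0 bp]] [symq [r' r'0 bq]]; split; first exact: adjD.
exists (r + r'); first exact: addr_ge0.
move=> x; have := bndD bp bq x; congr (nrm _ <= _).
by rewrite rmorphD /=; lin_eq R[i].
Qed.

Lemma sposZ r p : 0 <= r -> spos p -> spos (fun x => r%:C *: p x).
Proof.
move=> r0 [symp [s s0 bp]]; split; first exact: adjZ.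
exists (r * s); first exact: mulr_ge0.
move=> x; have := bndZ r0 bp x; congr (nrm _ <= _).
by rewrite rmorphM /=; lin_eq R[i].
Qed.

Lemma spos_ext p q : (forall x, p x = q x) -> spos p -> spos q.
Proof. by move=> pq; have -> : q = p by apply: funext. Qed.

Lemma bnd_scal r : 0 <= r -> bnd (fun x => r%:C *: x) r.
Proof. by move=> r0 x; rewrite nrmZp. Qed.

Lemma spos_bnd p : spos p -> exists2 r, 0 <= r & bnd p r.
Proof.
move=> [_ [r r0 bp]]; exists (r + r); first exact: addr_ge0.
move=> x; have := bndB (bnd_scal r0) bp x; congr (nrm _ <= _).
by lin_eq R[i].
Qed.

(* [u = m + i l] satisfies [u^* u = r^2] and [u + u^* = 2 m]. *)
Lemma commuting_squares_bnd m l r : sym m -> sym l -> 0 <= r ->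
  (forall x, m (l x) = l (m x)) ->
  (forall x, m (m x) + l (l x) = (r ^+ 2)%:C *: x) -> bnd m r.
Proof.
move=> symm syml r0 ml sum_sq.
pose u x := m x + 'i *: l x; pose v x := m x - 'i *: l x.
have uv : adj u v.
  move=> x y; rewrite ipDl ipDr ipNr ipZl symm syml; congr (_ + _).
  rewrite -[in RHS]ip_star ipZl cstarZ ip_star -scaleNr; congr (_ *: _).
  by apply/eqP; rewrite eq_complex /= oppr0 opprK !eqxx.
have ii : 'i * 'i = -1 :> R[i] by rewrite -expr2 sqr_i.
have bu : bnd u r.
  apply: (bnd_cstar uv) => // x; rewrite /= /u /v.
  rewrite !(adj_add symm) !(adj_add syml) !(adj_scale symm) !(adj_scale syml) ml.
  rewrite scalerDr scalerA ii scaleN1r.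
  have -> : m (m x) + 'i *: l (m x) - ('i *: l (m x) - l (l x)) = m (m x) + l (l x).
    by lin_eq R[i].
  by rewrite sum_sq nrmZp ?sqr_ge0.
have bv := bnd_adj uv r0 bu.
move=> x; have := bndD bu bv x; rewrite /u /v.
have -> : m x + 'i *: l x + (m x - 'i *: l x) = (2 : R)%:C *: m x.
  by rewrite rmorphD rmorph1; lin_eq R[i].
by rewrite nrmZp//; lra.
Qed.

(* If [k] is a contraction, then [1 - k^2 = b^2] and [b^2 + k^2 = 1]. *)
Lemma bnd_sq k r : sym k -> 0 <= r -> bnd k r ->
  bnd (fun x => (r ^+ 2)%:C *: x - k (k x)) (r ^+ 2).
Proof.
move=> symk r0 bk; have [r_eq0|r_neq0] := eqVneq r 0.
  move=> x; have kx : k (k x) = 0.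
    by apply: nrm_eq0; apply/le_anti; rewrite nrm_ge0 (le_trans (bk _))// r_eq0 mul0r.
  by rewrite r_eq0 expr0n kx subr0 /= scale0r nrm0 mul0r.
have {r_neq0}r_gt0 : 0 < r by rewrite lt_neqAle eq_sym r_neq0.
have r_neq0 : r != 0 by rewrite gt_eqF.
pose T x := (r ^- 2)%:C *: k (k x).
have symT : sym T by apply: adjZ; exact: (adj_comp symk symk).
have bT : bnd T 1.
  have -> : 1 = r ^- 2 * (r * r) by field.
  by apply: bndZ; rewrite ?invr_ge0 ?sqr_ge0//; exact: (bnd_comp r0 bk bk).
have [b [symb bb _ bC]] := sqrt_ex symT bT.
have b1 : bnd b 1.
  apply: (@commuting_squares_bnd _ (fun x => (r^-1)%:C *: k x)) => //.
  - exact: adjZ.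
  - move=> x; rewrite (adj_scale symb); congr (_ *: _).
    apply/esym/(bC _ r) => //; first exact: (adj_add symk).
      exact: (adj_scale symk).
    by move=> y; rewrite /T (adj_scale symk).
  - move=> x; rewrite bb (adj_scale symk) scalerA -rmorphM /= /T.
    rewrite -expr2 exprVn expr1n rmorph1 scale1r; lin_eq R[i].
move=> x.
have -> : (r ^+ 2)%:C *: x - k (k x) = (r ^+ 2)%:C *: b (b x).
  rewrite bb /T scalerBr scalerA -rmorphM /= mulfV ?rmorph1 ?scale1r//.
  by rewrite sqrf_eq0.
rewrite nrmZp ?sqr_ge0// ler_wpM2l ?sqr_ge0//.
by rewrite (le_trans (b1 _))// mul1r (le_trans (b1 _))// mul1r.
Qed.

Lemma spos_sq k r : sym k -> 0 <= r -> bnd k r -> spos (k \o k).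
Proof.
move=> symk r0 bk; split; first exact: (adj_comp symk symk).
by exists (r ^+ 2); [exact: sqr_ge0|exact: bnd_sq].
Qed.

Lemma spos_root p : spos p -> exists k, [/\ spos k, forall x, k (k x) = p x &
  forall V r, (forall x y, V (x + y) = V x + V y) ->
      (forall a x, V (a *: x) = a *: V x) -> bnd V r ->
      (forall x, V (p x) = p (V x)) -> forall x, V (k x) = k (V x)].
Proof.
move=> [symp [r0 r0_ge0 bp0]]; pose r := r0 + 1.
have r_gt0 : 0 < r by rewrite ltr_wpDl.
have r_neq0 : r != 0 by rewrite gt_eqF.
have bp : bnd (fun x => r%:C *: x - p x) r by apply: bnd_shift bp0; rewrite lerDl.
(* [T = 1 - p / r] is a contraction, so [sqrt_ex] yields [b] with [b^2 = p / r]. *)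
pose T x := (r^-1)%:C *: (r%:C *: x - p x).
have symT : sym T by apply: adjZ; apply: adjB => //; exact: adj_scal.
have bT : bnd T 1.
  have -> : 1 = r^-1 * r by rewrite mulVf.
  by apply: bndZ => //; rewrite invr_ge0 ltW.
have [b [symb bb b1 bC]] := sqrt_ex symT bT.
have s0 : 0 <= Num.sqrt r by exact: sqrtr_ge0.
exists (fun x => (Num.sqrt r)%:C *: b x); split.
- split; first exact: adjZ.
  exists (Num.sqrt r) => // x; have := bndZ s0 b1 x; rewrite mulr1.
  by congr (nrm _ <= _); lin_eq R[i].
- move=> x; rewrite (adj_scale symb) scalerA -rmorphM -expr2 sqr_sqrtr ?ltW//.
  by rewrite bb /T scalerBr scalerA -rmorphM /= divff// rmorph1; lin_eq R[i].
- move=> V s VD VZ bV VC x; rewrite VZ; congr (_ *: _).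
  apply: (bC V s) => // y.
  by rewrite /T VZ VD -scaleN1r !VZ VC scaleN1r.
Qed.

(* [N - p = q + (N - p - q)] is positive, so that [p = m^2] and [N - p = l^2]
   are commuting squares with sum [N]. *)
Lemma spos_le_bnd p q N : spos p -> spos q -> 0 <= N ->
  bnd (fun x => p x + q x) N -> bnd p N.
Proof.
move=> sp sq N0 bpq; have [symp _] := sp.
have [s s0 bp] := spos_bnd sp.
have spN : spos (fun x => N%:C *: x - p x).
  apply: (@spos_ext (fun x => q x + (N%:C *: x - (p x + q x)))).
    by move=> x; lin_eq R[i].
  apply: sposD => //; split.
    by apply: adjB; [exact: adj_scal|apply: adjD => //; case: sq].
  exists N => // x; have := bpq x; congr (nrm _ <= _); lin_eq R[i].
have [m [sm mm mC]] := spos_root sp; have [symm _] := sm.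
have [rm rm0 bm] := spos_bnd sm.
have [l [[syml _] ll lC]] := spos_root spN.
have ml x : m (l x) = l (m x).
  apply: (lC m rm) => //; [exact: (adj_add symm)|exact: (adj_scale symm)|].
  by move=> y; rewrite (adj_sub symm) (adj_scale symm) -!mm.
have sN : 0 <= Num.sqrt N by exact: sqrtr_ge0.
have bmN : bnd m (Num.sqrt N).
  apply: (commuting_squares_bnd symm syml) => // x.
  by rewrite mm ll sqr_sqrtr//; lin_eq R[i].
move=> x; rewrite -mm -(sqr_sqrtr N0) expr2; exact: (bnd_comp sN bmN bmN).
Qed.

End PositiveOperators.

(** * Positivity of [S T] for an adjoint pair *)

Section Fukamiya.
Variables (R : realType) (A : cstarAlgType R) (X : ipSpace A).
Implicit Types (x y : X) (c w g h k n S T : X -> X) (r N : R).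

(* [x^* x + x x^* = 2 ((Re x)^2 + (Im x)^2)]. *)
Lemma spos_anticommutator c c' r : adj c c' -> 0 <= r -> bnd c r ->
  spos (fun x => c (c' x) + c' (c x)).
Proof.
move=> cc' r0 bc; have c'c := adjC cc'; have bc' := bnd_adj cc' r0 bc.
pose a x := c x + c' x; pose d x := 'i *: (c x - c' x).
have ii : 'i * 'i = -1 :> R[i] by rewrite -expr2 sqr_i.
have syma : sym a.
  by move=> x y; rewrite ipDl ipDr cc' c'c addrC.
have symd : sym d.
  move=> x y; rewrite ipZl ipDl ipNl cc' c'c.
  rewrite -[in RHS]ip_star ipZl cstarZ ip_star ipDr ipNr.
  have -> : Num.conj ('i : R[i]) = - 'i.
    by apply/eqP; rewrite eq_complex /= oppr0 !eqxx.
  by lin_eq R[i].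
have ba : bnd a (r + r) by exact: bndD.
have bd : bnd d (r + r) by move=> x; rewrite nrm_i; exact: bndB.
have rr0 : 0 <= r + r by exact: addr_ge0.
have h0 : 0 <= (2^-1 : R) by rewrite invr_ge0.
have := sposZ h0 (sposD (spos_sq syma rr0 ba) (spos_sq symd rr0 bd)).
apply: spos_ext => x /=; rewrite /a /d.
rewrite !(adj_scale cc') !(adj_scale c'c) !(adj_sub cc') !(adj_sub c'c).
rewrite !(adj_add cc') !(adj_add c'c).
rewrite -scalerBr scalerA ii scaleN1r.
have E : (2^-1 : R)%:C + (2^-1 : R)%:C = 1 :> R[i].
  by rewrite -rmorphD /= (_ : 2^-1 + 2^-1 = 1 :> R) ?rmorph1//; lra.
have dbl (u : X) : (2^-1 : R)%:C *: (u + u) = u by rewrite scalerDr -scalerDl E scale1r.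
rewrite -[RHS]dbl; congr (_ *: _); lin_eq R[i].
Qed.

Section Kaplansky.
Variables (c c' w : X -> X) (r : R).
Hypotheses (cc' : adj c c') (r0 : 0 <= r) (bc : bnd c r).
Hypotheses (symw : sym w) (bw : exists2 s, 0 <= s & bnd w s).
Hypothesis c'cE : forall x, c' (c x) = - w (w x).

Let g := c \o c'.

(** [c c' = (c c' + c' c) + w^2], a sum of positive operators. *)
Lemma kaplansky_spos : spos g.
Proof.
have [s s0 bws] := bw.
have := sposD (spos_anticommutator cc' r0 bc) (spos_sq symw s0 bws).
by apply: spos_ext => x; rewrite /g /= c'cE; lin_eq R[i].
Qed.

(* [c' (N + g) = (N - w^2) c'] has norm at most [N sqrt N], whereas
   [(N + g) g (N + g) >= 2 N g^2]. *)
Lemma kaplansky_contract N : 0 < N -> bnd g N -> bnd g (3 / 4 * N).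
Proof.
move=> N_gt0 bg; have N0 := ltW N_gt0.
have sg := kaplansky_spos; have [symg _] := sg.
have c'c := adjC cc'.
pose s := Num.sqrt N; have s0 : 0 <= s by exact: sqrtr_ge0.
have sN : s ^+ 2 = N by exact: sqr_sqrtr.
have bc's : bnd c' s by apply: (bnd_cstar c'c) => //; rewrite sN.
have bcs := bnd_adj c'c s0 bc's.
have bws : bnd w s.
  apply: (bnd_cstar symw) => // x /=; rewrite -nrmN -c'cE expr2.
  exact: (bnd_comp s0 bc's bcs).
have bNw := bnd_sq symw s0 bws; rewrite sN in bNw.
pose d y := c' (N%:C *: y + g y).
pose d' x := N%:C *: c x + g (c x).
have dd' : adj d d'.
  move=> x y; rewrite /d /d' c'c ipDl ipDr ipZl ipZr symg; congr (_ + _).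
have bd : bnd d (N * s).
  move=> y; have -> : d y = N%:C *: c' y - w (w (c' y)).
    by rewrite -c'cE /d (adj_add c'c) (adj_scale c'c).
  exact: (bnd_comp N0 bNw bc's).
have Ns0 : 0 <= N * s by exact: mulr_ge0.
have bd' := bnd_adj dd' Ns0 bd.
have sgg := spos_sq symg N0 bg.
(* [g^3] is the square of [v g], where [v] is the root of [g] and commutes with it. *)
have sggg : spos (fun x => g (g (g x))).
  have [v [sv vv vC]] := spos_root sg; have [symv _] := sv.
  have [t t0 bv] := spos_bnd sv.
  have gv x : g (v x) = v (g x).
    by apply: (vC g N) => //; [exact: (adj_add symg)|exact: (adj_scale symg)].
  have symvg : sym (v \o g).
    by move=> x y /=; rewrite symv symg gv.
  apply: spos_ext (spos_sq symvg (mulr_ge0 t0 N0) (bnd_comp t0 bv bg)) => x /=.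
  by rewrite gv vv.
have bp : bnd (fun x => (2 * N)%:C *: g (g x)) (N ^+ 3).
  apply: (@spos_le_bnd _ _ _ _ (fun x => (N ^+ 2)%:C *: g x + g (g (g x)))).
  - by apply: sposZ => //; rewrite mulr_ge0.
  - by apply: sposD => //; apply: sposZ => //; rewrite sqr_ge0.
  - exact: exprn_ge0.
  - move=> x; have := bnd_comp Ns0 bd' bd x; congr (nrm _ <= _ * _).
      have -> : (d' \o d) x =
          N%:C *: g (N%:C *: x + g x) + g (g (N%:C *: x + g x)).
        by [].
      rewrite !(adj_add symg, adj_scale symg).
      by rewrite !rmorphM rmorphD rmorph1 /=; lin_eq R[i].
    by rewrite mulrACA -!expr2 sN -exprSr.
(* [bp] gives [|g|^2 <= N^2 / 2], and [1/2 <= 9/16]; any constant between the root of [1/2] and 1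
   would do in place of [3/4]. *)
apply: (bnd_cstar symg); first by rewrite mulr_ge0// divr_ge0.
move=> x; have := bp x; rewrite nrmZp ?mulr_ge0//=.
have := nrm_ge0 x; have := nrm_ge0 (g (g x)) => g0 x0.
rewrite (_ : N ^+ 3 * nrm x = (2 * N) * (N ^+ 2 / 2 * nrm x)); last by field.
rewrite ler_pM2l ?mulr_gt0// => /le_trans; apply; rewrite ler_wpM2r//.
by rewrite exprMn; have := sqr_ge0 N; lra.
Qed.

(** Iterating the contraction drives the bound of [g] to 0. This replaces the classical comparison
    of the spectra of [c c'] and [c' c]. *)
Lemma kaplansky : forall x, c (c' x) = 0.
Proof.
move=> x; have [N0 N00 bg0] := spos_bnd kaplansky_spos.
pose N := N0 + 1; have N_gt0 : 0 < N by rewrite ltr_wpDl.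
have bg (j : nat) : bnd g (N * (3 / 4) ^+ j).
  elim: j => [|j IH]; first by rewrite mulr1; apply: bnd_le bg0; rewrite lerDl.
  have := kaplansky_contract (mulr_gt0 N_gt0 (exprn_gt0 j _)) IH.
  by rewrite exprS mulrCA; apply; lra.
apply: nrm_small => e e0.
have q01 : 0 <= (3 / 4 : R) < 1 by lra.
have Nx0 := mulr_ge0 (ltW N_gt0) (nrm_ge0 x).
have [M MP] := geometric_small q01 Nx0 e0.
rewrite (le_trans (bg M x))//.
by have := MP M (leqnn _); rewrite mulrAC.
Qed.

End Kaplansky.

(* Kaplansky's argument: with [h = S T], [k = sqrt (h^2)] and [n = k - h], twice
   the negative part of [h], the operator [c = T n] satisfies
   [c^* c = n h n = - n k n], so that [c = 0] and then [n = 0]. *)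
Lemma spos_adj S T r : adj T S -> 0 <= r -> bnd T r -> spos (S \o T).
Proof.
move=> TS r0 bT; have ST := adjC TS; have bS := bnd_adj TS r0 bT.
pose h := S \o T; have symh : sym h by exact: adj_comp.
have rr0 := mulr_ge0 r0 r0; have bh : bnd h (r * r) by exact: bnd_comp.
have [k [sk kk kC]] := spos_root (spos_sq symh rr0 bh); have [symk _] := sk.
have [rk rk0 bk] := spos_bnd sk.
have hk x : h (k x) = k (h x).
  by apply: (kC h (r * r)) => //; [exact: (adj_add symh)|exact: (adj_scale symh)].
pose n x := k x - h x; have symn : sym n by exact: adjB.
have bn : bnd n (rk + r * r) by exact: bndB.
have rn0 : 0 <= rk + r * r by exact: addr_ge0.
have hn x : h (n x) = - k (n x).
  by rewrite (adj_sub symh) (adj_sub symk) hk kk /=; lin_eq R[i].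
have [q [sq qq qC]] := spos_root sk; have [symq _] := sq.
have [rq rq0 bq] := spos_bnd sq.
have nq x : n (q x) = q (n x).
  apply: (qC n (rk + r * r)) => //; [exact: (adj_add symn)|exact: (adj_scale symn)|].
  by move=> y; rewrite /n (adj_sub symk) hk.
(* Since [q^2 = k] and [q] commutes with [n], [w^2 = n k n], which exhibits [c' c = n h n] as minus
   a square. *)
pose w := q \o n.
have symw : sym w by move=> x y; rewrite /w /= symq symn nq.
have bw : bnd w (rq * (rk + r * r)) by exact: bnd_comp.
pose c := T \o n; pose c' := n \o S.
have cc' : adj c c' by exact: adj_comp.
have bc : bnd c (r * (rk + r * r)) by exact: bnd_comp.
have c'cE x : c' (c x) = - w (w x).
  by rewrite /c' /c /w /= -[S (T (n x))]/(h (n x)) hn (adj_opp symn) -qq nq.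
have bw' : exists2 s, 0 <= s & bnd w s.
  by exists (rq * (rk + r * r)); rewrite ?mulr_ge0.
have c'0 x : c' x = 0.
  apply: ip_eq0; rewrite (adjC cc').
  by rewrite (kaplansky cc' (mulr_ge0 r0 rn0) bc symw bw' c'cE) ip0r.
have w0 x : w x = 0.
  by apply: ip_eq0; rewrite symw -[w (w x)]opprK -c'cE c'0 oppr0 ip0r.
have n0 x : n x = 0.
  have kn : k (n x) = 0.
    by rewrite -qq -[q (n x)]/(w x) w0 (adj0 symq).
  by apply: ip_eq0; rewrite symn {1}/n hn kn oppr0 subrr ip0r.
by apply: spos_ext sk => x; apply/subr0_eq/n0.
Qed.

Lemma spos_conj p S T r : spos p -> adj T S -> 0 <= r -> bnd T r ->
  spos (S \o p \o T).
Proof.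
move=> sp TS r0 bT; have [k [sk kk _]] := spos_root sp; have [symk _] := sk.
have [rk rk0 bk] := spos_bnd sk.
have := spos_adj (adj_comp symk TS) (mulr_ge0 rk0 r0) (bnd_comp rk0 bk bT).
by apply: spos_ext => x /=; rewrite kk.
Qed.

End Fukamiya.

(** * The order on the algebra *)

Section Positive.
Variables (R : realType) (A : cstarAlgType R).
Implicit Types (a b p q : A) (r N : R).

(** With this order of the factors, left multiplications by [a] and [cstar a] are adjoint to each
    other. *)
Definition alg_ip a b := cmul (cstar b) a.

Lemma alg_ipDl a b p : alg_ip (a + b) p = alg_ip a p + alg_ip b p.
Proof. exact: cmulDr. Qed.

Lemma alg_ipZl (k : R[i]) a b : alg_ip (k *: a) b = k *: alg_ip a b.
Proof. exact: cmulZr. Qed.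

Lemma alg_ip_star a b : cstar (alg_ip a b) = alg_ip b a.
Proof. by rewrite /alg_ip cstarM cstarK. Qed.

Lemma alg_ip_norm a : nrm (alg_ip a a) = nrm a ^+ 2.
Proof. exact: nrm_starM. Qed.

Lemma alg_ip_cs a b : nrm (alg_ip a b) <= nrm a * nrm b.
Proof. by rewrite (le_trans (nrm_cmul _ _))// nrm_cstar mulrC. Qed.

Definition alg_space : ipSpace A :=
  IpSpace alg_ipDl alg_ipZl alg_ip_star alg_ip_norm alg_ip_cs.

Definition lmul a : alg_space -> alg_space := cmul a.

Lemma lmul_adj a : adj (lmul a) (lmul (cstar a)).
Proof. by move=> x y; rewrite /= /alg_ip /lmul cstarM cstarK cmulA. Qed.

Lemma lmul_bnd a r : nrm a <= r -> bnd (lmul a) r.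
Proof.
by move=> ar x; rewrite (le_trans (nrm_cmul _ _))// ler_wpM2r ?nrm_ge0.
Qed.

(** Evaluating at [cstar a] takes the place of evaluating at a unit: [|a a^*| = |a|^2]. *)
Lemma bnd_lmul a r : 0 <= r -> bnd (lmul a) r -> nrm a <= r.
Proof.
move=> r0 /(_ (cstar a)); rewrite /lmul -{1}(cstarK a) nrm_starM nrm_cstar.
have [->//|a0] := eqVneq (nrm a) 0.
by rewrite expr2 ler_pM2r// lt_neqAle eq_sym a0 nrm_ge0.
Qed.

Definition cpos p := spos (lmul p).

Lemma cpositive_cpos p : cpositive p -> cpos p.
Proof.
move=> [b ->].
have := spos_adj (lmul_adj b) (nrm_ge0 b) (lmul_bnd (lexx (nrm b))).
by apply: spos_ext => x; rewrite /lmul /= cmulA.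
Qed.

Lemma cposD p q : cpos p -> cpos q -> cpos (p + q).
Proof.
by move=> cp cq; apply: spos_ext (sposD cp cq) => x; rewrite /lmul cmulDl.
Qed.

Lemma cposZ r p : 0 <= r -> cpos p -> cpos (r%:C *: p).
Proof.
by move=> r0 cp; apply: spos_ext (sposZ r0 cp) => x; rewrite /lmul cmulZl.
Qed.

Lemma cpos_le p q : cpos p -> cpos q -> nrm p <= nrm (p + q).
Proof.
move=> cp cq; apply: bnd_lmul; rewrite ?nrm_ge0//.
apply: (spos_le_bnd cp cq); first exact: nrm_ge0.
by move=> x; rewrite /lmul -cmulDl; exact: lmul_bnd.
Qed.

Lemma cpos_mul_star a : cpos (cmul a (cstar a)).
Proof. by apply: cpositive_cpos; exists (cstar a); rewrite cstarK. Qed.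

(** This is the positivity of [a (N - p) a^*], where [N - p] is an operator on [A] and need not be
    an element. *)
Lemma cpos_conj_le a p N : cpos p -> nrm p <= N ->
  cpos (N%:C *: cmul a (cstar a) - cmul (cmul a p) (cstar a)).
Proof.
move=> cp pN; have N0 : 0 <= N by rewrite (le_trans (nrm_ge0 p)).
have sNp : spos (fun x : alg_space => N%:C *: x - lmul p x).
  split; first by apply: adjB; [exact: adj_scal|case: cp].
  exists N => // x; have := lmul_bnd pN x; congr (nrm _ <= _); lin_eq R[i].
have := spos_conj sNp (lmul_adj (cstar a)) (nrm_ge0 _) (lmul_bnd (lexx _)).
rewrite cstarK; apply: spos_ext => x.
by rewrite /lmul /= !(cmulDl, cmulDr, cmulNl, cmulNr, cmulZl, cmulZr) !cmulA.
Qed.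

End Positive.

(** * Hilbert modules *)

Section PreModules.
Variables (R : realType) (A : cstarAlgType R).

(** No norm is bundled: the type [E * F] already carries the max norm, so the Hilbert norm of the
    direct sum has to be derived from the inner product, as [pn]. *)
Record preModule := PreModule {
  pm_car :> lmodType R[i];
  pact : A -> pm_car -> pm_car;
  pip : pm_car -> pm_car -> A;
  pip_Dl : forall x y z, pip (x + y) z = pip x z + pip y z;
  pip_Zl : forall (k : R[i]) x y, pip (k *: x) y = k *: pip x y;
  pip_act : forall a x y, pip (pact a x) y = cmul a (pip x y);
  pip_star : forall x y, cstar (pip x y) = pip y x;
  pip_cpos : forall x, cpos (pip x x);
  pip_def : forall x, pip x x = 0 -> x = 0
}.

Variable V : preModule.
Implicit Types (x y z : V) (r : R) (P Q : V -> V).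

Lemma pip_Dr x y z : pip x (y + z) = pip x y + pip x z.
Proof. by rewrite -pip_star pip_Dl cstarD !pip_star. Qed.

Lemma pip_0l x : pip 0 x = 0.
Proof. by apply: (addrI (pip 0 x)); rewrite -pip_Dl !addr0. Qed.

Lemma pip_0r x : pip x 0 = 0.
Proof. by rewrite -pip_star pip_0l cstar0. Qed.

Lemma pip_Nl x y : pip (- x) y = - pip x y.
Proof. by apply: (addrI (pip x y)); rewrite -pip_Dl !subrr pip_0l. Qed.

Lemma pip_Nr x y : pip x (- y) = - pip x y.
Proof. by rewrite -pip_star pip_Nl cstarN pip_star. Qed.

Lemma pip_Zr r x y : pip x (r%:C *: y) = r%:C *: pip x y.
Proof. by rewrite -pip_star pip_Zl cstarZ pip_star conj_realC. Qed.

Lemma pip_actr a x y : pip x (pact a y) = cmul (pip x y) (cstar a).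
Proof. by rewrite -pip_star pip_act cstarM pip_star. Qed.

Definition pn x : R := Num.sqrt (nrm (pip x x)).

Lemma pn_ge0 x : 0 <= pn x. Proof. exact: sqrtr_ge0. Qed.

Lemma sqr_pn x : pn x ^+ 2 = nrm (pip x x).
Proof. by rewrite sqr_sqrtr// nrm_ge0. Qed.

(* The positive element [<v, v>], for [v = x - r <x, y> y] and [r = 1 / N] with
   [N >= |<y, y>|], is at most [<x, x> - r <x, y> <x, y>^*]. *)
Lemma pip_cs x y : nrm (pip x y) <= pn x * pn y.
Proof.
rewrite -(@ler_pXn2r _ 2)// ?nnegrE ?mulr_ge0 ?nrm_ge0 ?pn_ge0//.
rewrite exprMn !sqr_pn -nrm_cstar -nrm_starM cstarK.
set c := pip x y; set p := pip y y; set s := nrm (pip x x).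
(* Strictness keeps [N] invertible even when [p = 0]; afterwards [N] decreases to [nrm p]. *)
have bound N : nrm p < N -> nrm (cmul c (cstar c)) <= s * N.
  move=> pN; have N0 : 0 < N by rewrite (le_lt_trans (nrm_ge0 p)).
  have N_neq0 : N != 0 by rewrite gt_eqF.
  pose r := N^-1; have r0 : 0 < r by rewrite invr_gt0.
  pose v := x - r%:C *: pact c y.
  have vv : pip v v + (r ^+ 2)%:C *: (N%:C *: cmul c (cstar c) -
      cmul (cmul c p) (cstar c)) = pip x x - r%:C *: cmul c (cstar c).
    rewrite /v !(pip_Dl, pip_Dr, pip_Nl, pip_Nr, pip_Zl, pip_Zr).
    rewrite !(pip_act, pip_actr).
    rewrite -(pip_star x y) -/c -/p cmulA.
    have -> : (r ^+ 2)%:C = r%:C * r%:C by rewrite -rmorphM.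
    have rN : r%:C * N%:C = 1 :> R[i] by rewrite -rmorphM /= mulVf ?rmorph1.
    rewrite scalerBr scalerA -mulrA rN mulr1; lin_eq R[i].
  have cv : cpos (pip x x - r%:C *: cmul c (cstar c)).
    rewrite -vv; apply: cposD; first exact: pip_cpos.
    apply: cposZ; first by rewrite sqr_ge0.
    by apply: cpos_conj_le; [exact: pip_cpos|exact: ltW].
  have := cpos_le (cposZ (ltW r0) (cpos_mul_star c)) cv.
  rewrite addrC subrK nrmZp; last exact: ltW.
  by rewrite mulrC /r ler_pdivrMr.
apply/ler_addgt0Pl => e e0; have s0 : 0 <= s by exact: nrm_ge0.
have s1 : 0 < s + 1 by rewrite ltr_wpDl.
have /bound : nrm p < nrm p + e / (s + 1) by rewrite ltrDl divr_gt0.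
move/le_trans; apply; rewrite mulrDr addrC lerD2r mulrCA ger_pMr//.
by rewrite ler_pdivrMr// mul1r lerDl.
Qed.

Lemma pn_eq0 x : pn x = 0 -> x = 0.
Proof.
by move=> x0; apply/pip_def/nrm_eq0; rewrite -sqr_pn x0 expr0n.
Qed.

Lemma pip_injr x y : (forall z, pip z x = pip z y) -> x = y.
Proof.
by move=> xy; apply/subr0_eq/pip_def; rewrite pip_Dr pip_Nr xy subrr.
Qed.

Lemma pnD x y : pn (x + y) <= pn x + pn y.
Proof.
rewrite -(@ler_pXn2r _ 2)// ?nnegrE ?addr_ge0 ?pn_ge0//.
rewrite sqr_pn pip_Dl !pip_Dr sqrrD.
have := nrmD (pip x x + pip x y) (pip y x + pip y y).
have := nrmD (pip x x) (pip x y); have := nrmD (pip y x) (pip y y).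
have := pip_cs x y; have := pip_cs y x; rewrite !sqr_pn; lra.
Qed.

Lemma pnN x : pn (- x) = pn x.
Proof. by rewrite /pn pip_Nl pip_Nr opprK. Qed.

Lemma pnB x y : pn (x - y) <= pn x + pn y.
Proof. by rewrite (le_trans (pnD _ _))// pnN. Qed.

Lemma pnZ r x : pn (r%:C *: x) = `|r| * pn x.
Proof.
rewrite /pn pip_Zl pip_Zr scalerA -rmorphM nrmZ sqrtrM ?normr_ge0//.
by rewrite -expr2 normrX sqrtr_sqr normr_id.
Qed.

Lemma pn0 : pn 0 = 0.
Proof. by rewrite /pn pip_0l nrm0 sqrtr0. Qed.

Lemma pn_orth x y : pip x y = 0 -> pn x <= pn (x + y).
Proof.
move=> xy; rewrite ler_sqrt ?nrm_ge0// pip_Dl !pip_Dr xy -(pip_star x y) xy.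
by rewrite cstar0 addr0 add0r; apply: cpos_le; exact: pip_cpos.
Qed.

Section Projections.
Variable P : V -> V.
Hypotheses (symP : forall x y, pip (P x) y = pip x (P y))
           (idP : forall x, P (P x) = P x).

Lemma proj_add x y : P (x + y) = P x + P y.
Proof. by apply: pip_injr => z; rewrite -symP !pip_Dr !symP. Qed.

Lemma proj0 : P 0 = 0.
Proof. by apply: (addrI (P 0)); rewrite -proj_add !addr0. Qed.

Lemma proj_opp x : P (- x) = - P x.
Proof. by apply: (addrI (P x)); rewrite -proj_add !subrr proj0. Qed.

Lemma proj_scal r x : P (r%:C *: x) = r%:C *: P x.
Proof. by apply: pip_injr => z; rewrite -symP !pip_Zr symP. Qed.

Lemma proj_orth x : pip (P x) (x - P x) = 0.
Proof. by rewrite pip_Dr pip_Nr -symP idP subrr. Qed.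

Lemma proj_le x : pn (P x) <= pn x.
Proof. by have := pn_orth (proj_orth x); rewrite addrC subrK. Qed.

Lemma projC_le x : pn (x - P x) <= pn x.
Proof.
have : pip (x - P x) (P x) = 0 by rewrite -pip_star proj_orth cstar0.
by move/pn_orth; rewrite subrK.
Qed.

End Projections.

(** [P - Q = (1 - Q) P - Q (1 - P)], and [Q (1 - P)] is the adjoint of [(1 - P) Q], whose bound it
    inherits. *)
Lemma proj_gap P Q r : 0 <= r ->
  (forall x y, pip (P x) y = pip x (P y)) ->
  (forall x y, pip (Q x) y = pip x (Q y)) -> (forall x, Q (Q x) = Q x) ->
  (forall x, pn (P x - Q (P x)) <= r * pn x) ->
  (forall x, pn (Q x - P (Q x)) <= r * pn x) ->
  forall x, pn (P x - Q x) <= (r + r) * pn x.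
Proof.
move=> r0 symP symQ idQ PQ QP x; pose e := Q (x - P x).
have -> : P x - Q x = (P x - Q (P x)) - e.
  rewrite /e (proj_add symQ) (proj_opp symQ); lin_eq R[i].
rewrite (le_trans (pnB _ _))// mulrDl lerD//.
have [e0|e_neq0] := eqVneq (pn e) 0; first by rewrite e0 mulr_ge0// pn_ge0.
rewrite -(@ler_pM2r _ (pn e)); last by rewrite lt_neqAle eq_sym e_neq0 pn_ge0.
rewrite -expr2 sqr_pn {1}/e symQ.
have -> : pip (x - P x) (Q e) = pip x (Q e - P (Q e)).
  by rewrite pip_Dl pip_Nl pip_Dr pip_Nr symP.
by rewrite (le_trans (pip_cs _ _))// mulrAC [leRHS]mulrC ler_wpM2l ?pn_ge0.
Qed.

End PreModules.

(** * Boundedness of adjointable maps *)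

Section UniformBoundedness.
Variables (R : realType) (A : cstarAlgType R) (X Y : ipSpace A).
Variables (t : X -> Y) (ts : Y -> X).
Hypothesis tts : forall x y, ip (t x) y = ip x (ts y).

(* Gliding hump: if [|y_n| <= 1] and [|ts y_n| > 4^n], then adding successively
   [3^-n ts y_n / |ts y_n|] with suitable signs produces [x] such that
   [2 |<t x, y_n>| >= (4 / 3)^n] for all [n]. *)
Lemma adjoint_unit_bounded : exists M : R, forall y, nrm y <= 1 -> nrm (ts y) <= M.
Proof.
apply: contrapT => unb.
have /choice[y yP] (n : nat) : exists y, nrm y <= 1 /\ 4 ^+ n < nrm (ts y).
  apply: contrapT => ny; apply: unb; exists (4 ^+ n) => y y1.
  by rewrite leNgt; apply/negP => ly; apply: ny; exists y.
pose L n := nrm (ts (y n)); pose q : R := 1 / 3.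
have L4 n : 4 ^+ n < L n by have [] := yP n.
have L0 n : 0 < L n by apply: le_lt_trans (L4 n); rewrite exprn_ge0.
have q0 n : 0 <= q ^+ n by rewrite exprn_ge0//; rewrite /q; lra.
pose f n x := ip x (ts (y n)).
pose h n := (q ^+ n / L n)%:C *: ts (y n).
have h_nrm n : nrm (h n) = q ^+ n.
  by rewrite nrmZp ?divr_ge0 ?(ltW (L0 n))// -/(L n) divfK// gt_eqF.
have fh n : nrm (f n (h n)) = q ^+ n * L n.
  rewrite /f /h ipZl nrmZp ?divr_ge0 ?(ltW (L0 n))// ip_norm -/(L n).
  by rewrite expr2 mulrA divfK// gt_eqF.
pose step n x := if q ^+ n * L n <= nrm (f n (x + h n)) then x + h n else x - h n.
(* If both signs failed, the difference [2 f n (h n)] would have norm less than [2 q^n L n], which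
   is its exact norm. *)
have step_f n x : q ^+ n * L n <= nrm (f n (step n x)).
  rewrite /step; case: ifPn => //; rewrite -ltNge => lt.
  rewrite leNgt; apply/negP => lt'.
  have := nrmB (f n (x + h n)) (f n (x - h n)).
  have -> : f n (x + h n) - f n (x - h n) = (2 : R)%:C *: f n (h n).
    by rewrite /f !ipDl ipNl rmorphD rmorph1; lin_eq R[i].
  by rewrite nrmZp// fh; lra.
pose u := fix u n : X := if n is n'.+1 then step n' (u n') else 0.
have du n : nrm (u n.+1 - u n) <= q ^+ n.
  rewrite /= /step; case: ifP => _.
    have -> : u n + h n - u n = h n by lin_eq R[i].
    by rewrite h_nrm.
  have -> : u n - h n - u n = - h n by lin_eq R[i].
  by rewrite nrmN h_nrm.
(* [3/2 q^n] is the tail of the geometric series of ratio [1/3]. Hence [|x - u n.+1| <= q^n / 2],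
   and the later steps destroy at most half of the hump [q^n L n]. *)
have [|n|x ux xu] := @dominated_lim _ X u (fun n => - (3 / 2 * q ^+ n)) 0.
- by move=> n; rewrite (le_trans (du n))// exprS /q; have := q0 n; rewrite /q; lra.
- by rewrite oppr_le0 mulr_ge0// divr_ge0.
have big n : (4 / 3) ^+ n / 2 <= nrm (t x).
  have fx : nrm (f n x) <= nrm (t x).
    rewrite /f -tts (le_trans (ip_cs _ _))//.
    by have [y1 _] := yP n; rewrite ler_piMr ?nrm_ge0.
  have := step_f n (u n); rewrite -/(u n.+1) => fu.
  have := nrmB (f n x) (f n (x - u n.+1)).
  have -> : f n x - f n (x - u n.+1) = f n (u n.+1).
    by rewrite /f !ipDl ipNl; lin_eq R[i].
  have : nrm (f n (x - u n.+1)) <= 1 / 2 * q ^+ n * L n.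
    rewrite (le_trans (ip_cs _ _))// ler_wpM2r ?nrm_ge0//.
    by rewrite (le_trans (xu _))// exprS /q; lra.
  have : (4 / 3) ^+ n <= q ^+ n * L n.
    have -> : 4 / 3 = q * 4 by rewrite /q; field.
    by rewrite exprMn ler_wpM2l// ltW.
  lra.
have tx0 := nrm_ge0 (t x).
have e0 : 0 < 1 / (2 * nrm (t x) + 1) by apply: divr_gt0; lra.
have q34 : 0 <= (3 / 4 : R) < 1 by lra.
have [N /(_ N (leqnn N))] := @geometric_small R (3 / 4) 1 _ q34 ler01 e0.
rewrite mul1r ler_pdivlMr; last lra.
have p0 : 0 < (3 / 4 : R) ^+ N by rewrite exprn_gt0//; lra.
have : (3 / 4 : R) ^+ N * (4 / 3) ^+ N = 1.
  by rewrite -exprMn (_ : 3 / 4 * (4 / 3) = 1) ?expr1n//; field.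
have := big N; nra.
Qed.

Lemma adjoint_bounded : exists2 M : R, 0 <= M & forall y, nrm (ts y) <= M * nrm y.
Proof.
have [M0 M0P] := adjoint_unit_bounded; exists (`|M0|) => // y.
have tsZ (r : R) v : ts (r%:C *: v) = r%:C *: ts v.
  by apply: ip_inj => z; rewrite -ip_star -tts ip_star ipZl -ip_star tts ip_star ipZl.
have [y0|y0] := eqVneq (nrm y) 0.
  have -> : y = (0 : R)%:C *: y by rewrite (nrm_eq0 y0) scaler0.
  by rewrite tsZ scale0r nrm0 mulr_ge0 ?nrm_ge0.
have y_gt0 : 0 < nrm y by rewrite lt_neqAle eq_sym y0 nrm_ge0.
have := M0P ((nrm y)^-1%:C *: y).
rewrite tsZ !nrmZp ?invr_ge0 ?nrm_ge0// mulVf// => /(_ (lexx _)).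
rewrite mulrC ler_pdivrMr// => /le_trans; apply.
by rewrite ler_wpM2r ?nrm_ge0// ler_norm.
Qed.

End UniformBoundedness.

Section HilbertModules.
Variables (R : realType) (A : cstarAlgType R).

Section One.
Variable E : hilbertModType A.
Implicit Types x y : E.

Lemma nrm_inner x : nrm (inner x x) = nrm x ^+ 2.
Proof. by apply: complexI; rewrite rmorphXn /= -!nrmE inner_norm. Qed.

Lemma inner_def x : inner x x = 0 -> x = 0.
Proof.
by move=> xx; apply/nrm_eq0/eqP; rewrite -sqrf_eq0 -nrm_inner xx nrm0.
Qed.

Lemma inner_cpos x : cpos (inner x x).
Proof. exact/cpositive_cpos/inner_ge0. Qed.

Definition hilb_pre : preModule A :=
  @PreModule R A E (@act R A E) (@inner R A E) (@innerDl R A E) (@innerZl R A E)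
    (@inner_act R A E) (@inner_star R A E) inner_cpos inner_def.

Lemma pn_hilb x : pn (x : hilb_pre) = nrm x.
Proof. by rewrite /pn /= nrm_inner sqrtr_sqr ger0_norm ?nrm_ge0. Qed.

Lemma inner_cs x y : nrm (inner x y) <= nrm x * nrm y.
Proof. by rewrite -!pn_hilb; exact: (@pip_cs _ _ hilb_pre). Qed.

Definition hilb_space : ipSpace A :=
  @IpSpace R A E (@inner R A E) (@innerDl R A E) (@innerZl R A E)
    (@inner_star R A E) nrm_inner inner_cs.

Lemma approx_dense (D : set E) :
  (forall x (e : R), 0 < e -> exists2 y, D y & nrm (x - y) <= e) -> dense D.
Proof.
move=> approx O [x Ox] oO; have /nbhs_ballP[e /= e0 eO] := open_nbhs_nbhs (conj oO Ox).
have [d dE] : exists d, e = d%:C by exists (complex.Re e); rewrite RRe_real// gtr0_real.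
move: e0 eO; rewrite {e}dE ltcR => d0 eO; have d2 : 0 < d / 2 by lra.
have [y Dy xy] := approx x _ d2; exists y; split=> //; apply: eO.
by rewrite -ball_normE /= nrmE ltcR (le_lt_trans xy)//; lra.
Qed.

Lemma dense_approx (D : set E) : dense D ->
  forall x (e : R), 0 < e -> exists2 y, D y & nrm (x - y) <= e.
Proof.
move=> dD x e e0; have e0' : 0 < e%:C by rewrite ltcR.
have [|y [/= xy Dy]] := dD (interior (ball x e%:C)) _ (open_interior _).
  by exists x; apply: nbhsx_ballx.
exists y => //; have /interior_subset := xy.
by rewrite -ball_normE /= nrmE ltcR => /ltW.
Qed.

End One.

Section Sum.
Variables E F : hilbertModType A.

Definition sum_act (a : A) (z : E * F) : E * F := (act a z.1, act a z.2).

Let sum_Dl (x y z : E * F) : sum_inner (x + y) z = sum_inner x z + sum_inner y z.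
Proof. by rewrite /sum_inner /= !innerDl addrACA. Qed.

Let sum_Zl (k : R[i]) (x y : E * F) : sum_inner (k *: x) y = k *: sum_inner x y.
Proof. by rewrite /sum_inner /= !innerZl scalerDr. Qed.

Let sum_actE a (x y : E * F) : sum_inner (sum_act a x) y = cmul a (sum_inner x y).
Proof. by rewrite /sum_inner /= !inner_act cmulDr. Qed.

Let sum_star (x y : E * F) : cstar (sum_inner x y) = sum_inner y x.
Proof. by rewrite /sum_inner cstarD !inner_star. Qed.

Let sum_cpos (x : E * F) : cpos (sum_inner x x).
Proof. by apply: cposD; exact: inner_cpos. Qed.

Lemma nrm_fst_le (z : E * F) : nrm z.1 <= sum_norm z.
Proof.
rewrite -[leLHS]ger0_norm ?nrm_ge0// -sqrtr_sqr -nrm_inner ler_sqrt ?nrm_ge0//.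
exact: cpos_le (inner_cpos _) (inner_cpos _).
Qed.

Lemma nrm_snd_le (z : E * F) : nrm z.2 <= sum_norm z.
Proof.
rewrite -[leLHS]ger0_norm ?nrm_ge0// -sqrtr_sqr -nrm_inner ler_sqrt ?nrm_ge0//.
rewrite -/(nrm _) /sum_inner addrC.
exact: cpos_le (inner_cpos _) (inner_cpos _).
Qed.

Let sum_def (z : E * F) : sum_inner z z = 0 -> z = 0.
Proof.
move=> zz; have z0 : sum_norm z = 0 by rewrite /sum_norm zz -/(nrm _) nrm0 sqrtr0.
have := nrm_fst_le z; have := nrm_snd_le z; rewrite z0 => z2 z1.
rewrite [z]surjective_pairing (@nrm_eq0 _ _ z.1); last first.
  by apply/le_anti; rewrite z1 nrm_ge0.
by rewrite (@nrm_eq0 _ _ z.2)//; apply/le_anti; rewrite z2 nrm_ge0.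
Qed.

Definition sum_pre : preModule A :=
  @PreModule R A (E * F)%type sum_act (@sum_inner R A E F) sum_Dl sum_Zl
    sum_actE sum_star sum_cpos sum_def.

Lemma sum_normE (z : E * F) : sum_norm z = pn (z : sum_pre). Proof. by []. Qed.

Lemma sum_norm_le (z : E * F) : sum_norm z <= nrm z.1 + nrm z.2.
Proof.
rewrite -(@ler_pXn2r _ 2)// ?nnegrE ?addr_ge0 ?sqrtr_ge0 ?nrm_ge0//.
rewrite sqr_sqrtr ?nrm_ge0// -/(nrm _) (le_trans (nrmD _ _))// !nrm_inner.
by have := nrm_ge0 z.1; have := nrm_ge0 z.2; nra.
Qed.

Lemma closed_approx (M : set (E * F)) : closed M -> forall w,
  (forall e : R, 0 < e ->
    exists2 z, M z & nrm (w.1 - z.1) <= e /\ nrm (w.2 - z.2) <= e) ->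
  M w.
Proof.
move=> cM w approx; rewrite (closure_id M).1// => U /nbhs_ballP[e /= e0 eU].
have [d dE] : exists d, e = d%:C by exists (complex.Re e); rewrite RRe_real// gtr0_real.
move: e0 eU; rewrite {e}dE ltcR => d0 eU; have d2 : 0 < d / 2 by lra.
have [z Mz [z1 z2]] := approx _ d2; exists z; split=> //; apply: eU.
by split; rewrite -ball_normE /= nrmE ltcR; lra.
Qed.

Lemma approx_closed (M : set (E * F)) : (forall w,
  (forall e : R, 0 < e ->
    exists2 z, M z & nrm (w.1 - z.1) <= e /\ nrm (w.2 - z.2) <= e) ->
  M w) -> closed M.
Proof.
move=> approx w cw; apply: approx => e e0; have e0' : 0 < e%:C by rewrite ltcR.
have [z [Mz]] := cw _ (nbhsx_ballx w _ e0').
by case; rewrite -!ball_normE /= !nrmE !ltcR => /ltW z1 /ltW z2; exists z.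
Qed.

End Sum.

End HilbertModules.

(** * Regular operators and their graphs *)

Section OperatorTheory.
Variables (R : realType) (A : cstarAlgType R) (E F : hilbertModType A).
Implicit Types (t s : operator E F) (x u : E) (y v : F) (r e : R).

Lemma inner_Dr (H : hilbertModType A) (a b c : H) :
  inner a (b + c) = inner a b + inner a c.
Proof. exact: (@ipDr _ _ (hilb_space H)). Qed.

Lemma inner_Nl (H : hilbertModType A) (a b : H) : inner (- a) b = - inner a b.
Proof. exact: (@ipNl _ _ (hilb_space H)). Qed.

Lemma inner_Nr (H : hilbertModType A) (a b : H) : inner a (- b) = - inner a b.
Proof. exact: (@ipNr _ _ (hilb_space H)). Qed.

Lemma inner_Zr (H : hilbertModType A) r (a b : H) :
  inner a (r%:C *: b) = r%:C *: inner a b.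
Proof. exact: (@ipZr _ _ (hilb_space H)). Qed.

Lemma inner_0l (H : hilbertModType A) (a : H) : inner 0 a = 0.
Proof. exact: (@ip0l _ _ (hilb_space H)). Qed.

Lemma inner_0r (H : hilbertModType A) (a : H) : inner a 0 = 0.
Proof. exact: (@ip0r _ _ (hilb_space H)). Qed.

Lemma op_domN t x : op_dom t x -> op_dom t (- x).
Proof. by move=> tx; rewrite -scaleN1r; exact: op_domZ. Qed.

Lemma op_domB t x x' : op_dom t x -> op_dom t x' -> op_dom t (x - x').
Proof. by move=> tx tx'; apply: op_domD => //; exact: op_domN. Qed.

Lemma op_appN t x : op_dom t x -> t (- x) = - t x.
Proof. by move=> tx; rewrite -scaleN1r op_appZ// scaleN1r. Qed.

Lemma op_appB t x x' : op_dom t x -> op_dom t x' -> t (x - x') = t x - t x'.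
Proof. by move=> tx tx'; rewrite op_appD ?op_appN//; exact: op_domN. Qed.

Lemma adjoint_rel_uniq t y w w' : adjoint_rel t y w -> adjoint_rel t y w' -> w = w'.
Proof.
move=> yw yw'; apply/subr0_eq; have [d dE] : exists d, d = w - w' by exists (w - w').
rewrite -dE.
apply: inner_def; apply: nrm_small => e e0.
have d1 : 0 < nrm d + 1 by rewrite ltr_wpDl ?nrm_ge0.
have [x tx dx] := dense_approx (@op_dom_dense _ _ _ _ t) d (divr_gt0 e0 d1).
have xd : inner x d = 0 by rewrite dE inner_Dr inner_Nr -yw// -yw'// subrr.
have -> : inner d d = inner (d - x) d by rewrite innerDl inner_Nl xd subr0.
rewrite (le_trans (inner_cs _ _))// (le_trans (ler_wpM2r (nrm_ge0 _) dx))//.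
by rewrite mulrAC ler_pdivrMr// ler_pM2l// lerDl.
Qed.

Lemma adjointE t y w : adjoint_rel t y w -> adjoint t y = w.
Proof.
move=> yw; apply: (@adjoint_rel_uniq t y) => //; rewrite /adjoint.
exact: (xgetPex 0 (ex_intro _ w yw)).
Qed.

Lemma adjoint_domP t y : adjoint_dom t y -> adjoint_rel t y (adjoint t y).
Proof. by move=> [w yw]; rewrite (adjointE yw). Qed.

Lemma adjoint_relB t y y' w w' : adjoint_rel t y w -> adjoint_rel t y' w' ->
  adjoint_rel t (y - y') (w - w').
Proof. by move=> yw yw' x tx; rewrite !inner_Dr !inner_Nr yw// yw'. Qed.

Lemma adjoint_rel0 t : adjoint_rel t 0 0.
Proof. by move=> x _; rewrite !inner_0r. Qed.

Lemma adjoint_rel_lim t (yn : nat -> F) (wn : nat -> E) y w :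
  (forall n, adjoint_rel t (yn n) (wn n)) -> lim_to yn y -> lim_to wn w ->
  adjoint_rel t y w.
Proof.
move=> yw limy limw x tx; apply: (@lim_to_uniq _ _ (fun n => inner (t x) (yn n))).
  apply: (@lim_to_map _ _ _ (fun v : F => inner (t x) v) (nrm (t x))) => // [a b|a].
    exact: inner_Dr.
  exact: inner_cs.
have -> : (fun n => inner (t x) (yn n)) = (fun n => inner x (wn n)).
  by apply: funext => n; rewrite yw.
apply: (@lim_to_map _ _ _ (fun v : E => inner x v) (nrm x)) => // [a b|a].
  exact: inner_Dr.
exact: inner_cs.
Qed.

Lemma graph_lim t (xn : nat -> E) x y : closed (graph t) ->
  (forall n, op_dom t (xn n)) -> lim_to xn x -> lim_to (fun n => t (xn n)) y ->
  op_dom t x /\ y = t x.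
Proof.
move=> ct tx limx limy; suff : graph t (x, y) by [].
apply: (closed_approx ct) => e e0.
have [N xN] := limx _ e0; have [M yM] := limy _ e0.
exists (xn (N + M)%N, t (xn (N + M)%N)); first by split=> /=.
by rewrite /= nrmC xN ?leq_addr// nrmC yM// leq_addl.
Qed.

Lemma lim_to_dominated (V W : completeNormedModType R[i]) (a : nat -> V)
    (b : nat -> W) (c : R) z :
  lim_to b z -> (forall n m, nrm (a n - a m) <= c * nrm (b n - b m)) ->
  exists l, lim_to a l.
Proof.
move=> bz ab; apply: cauchy_lim_to => e e0.
have c1 : 0 < `|c| + 1 by rewrite ltr_wpDl.
have e2 : 0 < e / (`|c| + 1) / 2 by rewrite !divr_gt0.
have [N bN] := bz _ e2; exists N => n m /bN bn /bN bm.
have bnm : nrm (b n - b m) <= e / (`|c| + 1).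
  by have := nrm_dist3 (b n) z (b m); rewrite (nrmC z); lra.
rewrite (le_trans (ab _ _))//.
rewrite (@le_trans _ _ ((`|c| + 1) * nrm (b n - b m)))//.
  rewrite ler_wpM2r ?nrm_ge0//; have := ler_norm c; lra.
by rewrite mulrC -ler_pdivlMr.
Qed.

Lemma dense_seq (H : hilbertModType A) (D : set H) : dense D -> forall z,
  exists2 a : nat -> H, forall n, D (a n) & lim_to a z.
Proof.
move=> dD z; have half_gt0 n : 0 < (2^-1 : R) ^+ n by rewrite exprn_gt0.
have /choice[a aP] (n : nat) : exists d, D d /\ nrm (z - d) <= (2^-1 : R) ^+ n.
  by have [d ? ?] := dense_approx dD z (half_gt0 n); exists d.
exists a => [n|e e0]; first by have [] := aP n.
have h01 : 0 <= (2^-1 : R) < 1 by lra.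
have [N NP] := @geometric_small R 2^-1 1 e h01 ler01 e0.
exists N => n /NP; rewrite mul1r nrmC; exact/le_trans/(proj2 (aP n)).
Qed.

(** * Regularity of bounded adjointable operators *)

Section BoundedRegular.
Variables (t : operator E F) (ts : F -> E).
Hypotheses (tT : op_dom t = setT) (tts : forall x y, inner (t x) y = inner x (ts y)).

Let dom_t x : op_dom t x. Proof. by rewrite tT. Qed.

Lemma bounded_rel y : adjoint_rel t y (ts y).
Proof. by move=> x _; exact: tts. Qed.

Lemma bounded_bound : exists2 M : R, 0 <= M &
  (forall x, nrm (t x) <= M * nrm x) /\ (forall y, nrm (ts y) <= M * nrm y).
Proof.
have [M M0 tM] := @adjoint_bounded R A (hilb_space E) (hilb_space F) t ts tts.
exists M => //; split=> // x.
have [->|tx0] := eqVneq (nrm (t x)) 0; first by rewrite mulr_ge0 ?nrm_ge0.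
rewrite -(@ler_pM2r _ (nrm (t x))); last by rewrite lt_neqAle eq_sym tx0 nrm_ge0.
rewrite -expr2 -nrm_inner tts (le_trans (inner_cs _ _))// mulrC mulrAC.
by rewrite ler_wpM2r ?nrm_ge0// tM.
Qed.

(* With [m > |t^* t|], write [1 - t^* t / m = b^2], where [|b| <= 1]; then
   [1 + t^* t = (m + 1) (1 - m / (m + 1) b^2)]. *)
Lemma bounded_surj z : exists x, z = x + ts (t x).
Proof.
have [M M0 [tM tsM]] := bounded_bound.
pose X := hilb_space E; pose m := M * M + 1.
have m_gt0 : 0 < m by rewrite ltr_wpDl// mulr_ge0.
have m_neq0 : m != 0 by rewrite gt_eqF.
pose T (x : X) : X := (m^-1)%:C *: ts (t x).
have symT : sym T.
  apply: (@adjZ _ _ X _ (fun x => ts (t x)) (fun x => ts (t x))) => x y /=.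
  by rewrite -inner_star -tts inner_star tts.
have bT : bnd T 1.
  move=> x; rewrite nrmZp ?invr_ge0 ?(ltW m_gt0)// mul1r mulrC ler_pdivrMr// mulrC.
  rewrite (le_trans (tsM _))// (le_trans (ler_wpM2l M0 (tM x)))// mulrA.
  by rewrite ler_wpM2r ?nrm_ge0// lerDl.
have [b [symb bb _ _]] := sqrt_ex symT bT.
have b1 : bnd b 1.
  move=> x; rewrite mul1r -(@ler_pXn2r _ 2)// ?nnegrE ?nrm_ge0// -!nrm_inner.
  have -> : inner x x = inner (b x) (b x) + (m^-1)%:C *: inner (t x) (t x).
    have := symb x (b x); rewrite bb /= => ->.
    by rewrite inner_Dr inner_Nr inner_Zr tts subrK.
  apply: cpos_le; first exact: inner_cpos.
  by apply: cposZ; [rewrite invr_ge0 ltW|exact: inner_cpos].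
pose q := m / (m + 1); have m1 : 0 < m + 1 by rewrite ltr_wpDl// ltW.
have q0 : 0 <= q by rewrite divr_ge0// ltW.
have q1 : q < 1 by rewrite ltr_pdivrMr// mul1r ltrDl.
pose S (x : X) : X := q%:C *: b (b x).
have symS : sym S by apply: adjZ; exact: adj_comp.
have bS : bnd S q.
  rewrite -[q]mulr1; apply: bndZ => //; rewrite -[1](mulr1 (1 : R)).
  exact: bnd_comp.
have [|x xE] := @neumann R X S q _ (adj_add symS) bS (((m + 1)^-1)%:C *: z).
  by rewrite q0.
exists x; apply: (scalerI (a := ((m + 1)^-1)%:C)).
  by rewrite -(rmorph0 (real_complex R)) (inj_eq (@complexI R)) invr_eq0 gt_eqF.
rewrite xE /S bb /T scalerBr scalerA -rmorphM /=.
have -> : q / m = (m + 1)^-1 by rewrite /q; field; rewrite m_neq0 gt_eqF.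
have -> : q = 1 - (m + 1)^-1 by rewrite /q; field; rewrite gt_eqF.
by rewrite rmorphB rmorph1; lin_eq R[i].
Qed.

Lemma bounded_regular : regular E F t.
Proof.
have [M M0 [tM _]] := bounded_bound.
split.
- apply: approx_closed => w approx; split=> //; apply/subr0_eq/nrm_small => e e0.
  have M1 : 0 < M + 1 by rewrite ltr_wpDl.
  have [z [_ z2] [w1 w2]] := approx _ (divr_gt0 e0 M1).
  have -> : e = e / (M + 1) + M * (e / (M + 1)) by field; rewrite gt_eqF.
  rewrite (le_trans (nrm_dist3 _ (t z.1) _))// -op_appB// -z2 lerD//.
  by rewrite (le_trans (tM _))// ler_wpM2l// nrmC.
- apply: approx_dense => y e e0; exists y; last by rewrite subrr nrm0 ltW.
  by exists (ts y); exact: bounded_rel.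
- apply: approx_dense => z e e0; have [x xE] := bounded_surj z.
  exists z; last by rewrite subrr nrm0 ltW.
  exists x; last by rewrite (adjointE (bounded_rel _)) -xE.
  by split=> //; exists (ts (t x)); exact: bounded_rel.
Qed.

End BoundedRegular.

(* [tt_rel t x u] reads [u = t^* t x]. *)
Definition tt_rel t x u := op_dom t x /\ adjoint_rel t (t x) u.

Lemma tt_relB t x x' u u' : tt_rel t x u -> tt_rel t x' u' ->
  tt_rel t (x - x') (u - u').
Proof.
move=> [tx xu] [tx' xu']; split; first exact: op_domB.
by rewrite op_appB//; exact: adjoint_relB.
Qed.

Lemma tt_rel_expand t x u e : tt_rel t x u ->
  inner (x + e%:C *: u) (x + e%:C *: u) =
  inner x x + (e%:C *: inner (t x) (t x) + e%:C *: inner (t x) (t x) +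
    inner (e%:C *: u) (e%:C *: u)).
Proof.
move=> [tx xu]; rewrite !innerDl !inner_Dr -!addrA; congr (_ + _).
rewrite !addrA; congr (_ + _); rewrite inner_Zr -(xu x)// innerZl.
by rewrite -(inner_star x u) -(xu x)// inner_star.
Qed.

(** The summands of [tt_rel_expand] are positive, so each is dominated in norm by the sum. These
    estimates give the injectivity of [1 + e t^* t] and the Cauchy estimates for its inverse. *)
Lemma tt_rel_bound t x u e : 0 <= e -> tt_rel t x u ->
  [/\ nrm x <= nrm (x + e%:C *: u), nrm (e%:C *: u) <= nrm (x + e%:C *: u) &
    e * nrm (t x) ^+ 2 <= nrm (x + e%:C *: u) ^+ 2].
Proof.
move=> e0 xu; have E2 := tt_rel_expand e xu.
have ct : cpos (e%:C *: inner (t x) (t x)) by apply: cposZ => //; exact: inner_cpos.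
split.
- rewrite -(@ler_pXn2r _ 2)// ?nnegrE ?nrm_ge0// -!nrm_inner E2.
  apply: cpos_le; first exact: inner_cpos.
  by apply: cposD; [exact: cposD|exact: inner_cpos].
- rewrite -(@ler_pXn2r _ 2)// ?nnegrE ?nrm_ge0// -!nrm_inner E2 addrA addrC.
  apply: cpos_le; first exact: inner_cpos.
  by apply: cposD; [exact: inner_cpos|exact: cposD].
- rewrite -!nrm_inner E2 -nrmZp// addrC -!addrA.
  apply: cpos_le => //; apply: cposD => //.
  by apply: cposD; exact: inner_cpos.
Qed.

(** * Orthogonal decomposition along the graph of a regular operator *)

Section Regular.
Variable t : operator E F.
Hypothesis regt : regular E F t.

Let closed_t : closed (graph t). Proof. by case: regt. Qed.

(** Along [w n] in the dense range tending to [z], [tt_rel_bound] makes [x n], [t (x n)] and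
    [t^* t (x n)] Cauchy; closedness of [t] and of its adjoint identifies the limits. *)
Lemma regular_surj z : exists x u, tt_rel t x u /\ z = x + u.
Proof.
have [_ _ dense_t] := regt; have [w wP wz] := dense_seq dense_t z.
have /choice[x xP] n : exists x, tt_rel t x (w n - x).
  have [x /= [tx /adjoint_domP xu] <-] := wP n; exists x; split=> //.
  by rewrite addrAC subrr add0r.
have bound n m : [/\ nrm (x n - x m) <= 1 * nrm (w n - w m),
    nrm ((w n - x n) - (w m - x m)) <= 1 * nrm (w n - w m) &
    nrm (t (x n) - t (x m)) <= 1 * nrm (w n - w m)].
  have [xn _] := xP n; have [xm _] := xP m.
  have := tt_rel_bound ler01 (tt_relB (xP n) (xP m)).
  rewrite op_appB// rmorph1 !scale1r !mul1r.
  have -> : x n - x m + (w n - x n - (w m - x m)) = w n - w m by lin_eq R[i].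
  by move=> [-> ->]; rewrite ler_pXn2r// ?nnegrE ?nrm_ge0.
have [x0 xx0] : exists x0, lim_to x x0.
  by apply: (lim_to_dominated (c := 1) wz) => n m; case: (bound n m).
have [u0 uu0] : exists u0, lim_to (fun n => w n - x n) u0.
  by apply: (lim_to_dominated (c := 1) wz) => n m; case: (bound n m).
have [y0 yy0] : exists y0, lim_to (fun n => t (x n)) y0.
  by apply: (lim_to_dominated (c := 1) wz) => n m; case: (bound n m).
have [tx0 y0E] := graph_lim closed_t (fun n => (xP n).1) xx0 yy0.
exists x0, u0; split; last first.
  apply: (lim_to_uniq wz); have := lim_toD xx0 uu0.
  by congr (lim_to _ _); apply: funext => n; rewrite addrC subrK.
split=> //; rewrite -y0E; exact: (adjoint_rel_lim (fun n => (xP n).2) yy0 uu0).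
Qed.

(* The decomposition [z = (x, t x) + (- w, y)] along the graph of [t] and its
   orthogonal complement, where [w = t^* y]. *)
Definition graph_dec (z : E * F) x y w :=
  [/\ op_dom t x, adjoint_rel t y w & z = (x - w, t x + y)].

Lemma graph_decB z z' x x' y y' w w' : graph_dec z x y w -> graph_dec z' x' y' w' ->
  graph_dec (z - z') (x - x') (y - y') (w - w').
Proof.
move=> [tx yw ->] [tx' yw' ->]; split; [exact: op_domB|exact: adjoint_relB|].
rewrite op_appB//; congr pair => /=; lin_eq R[i].
Qed.

Lemma graph_orth x y w : op_dom t x -> adjoint_rel t y w ->
  sum_inner (x, t x) (- w, y) = 0.
Proof. by move=> tx yw; rewrite /sum_inner /= inner_Nr yw// addNr. Qed.

Lemma graph_dec_bound z x y w : graph_dec z x y w ->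
  [/\ nrm x <= sum_norm z, nrm (t x) <= sum_norm z,
      nrm y <= sum_norm z & nrm w <= sum_norm z].
Proof.
move=> [tx yw zE]; have o := graph_orth tx yw.
have zE' : z = (x, t x) + (- w, y) by rewrite zE.
have g1 : sum_norm (x, t x) <= sum_norm z.
  by rewrite zE' !sum_normE; exact: (@pn_orth _ _ (sum_pre E F)).
have g2 : sum_norm (- w, y) <= sum_norm z.
  rewrite zE' addrC !sum_normE; apply: (@pn_orth _ _ (sum_pre E F)).
  by rewrite -pip_star [pip _ _]o cstar0.
split.
- exact: le_trans (nrm_fst_le (x, t x)) g1.
- exact: le_trans (nrm_snd_le (x, t x)) g1.
- exact: le_trans (nrm_snd_le (- w, y)) g2.
- by rewrite -nrmN; exact: le_trans (nrm_fst_le (- w, y)) g2.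
Qed.

(** Applying [t^*] to [y = t x' + y'] turns the decomposition into the solvable equation
    [x' + t^* t x' = x + t^* y]. That [x'] lies in the domain of [t^* t] is what later density
    arguments use. *)
Lemma graph_dec_tt x y : adjoint_dom t y ->
  exists x' y' w' u, graph_dec (x, y) x' y' w' /\ tt_rel t x' u.
Proof.
move=> [w yw]; have [x' [u [xu E1]]] := regular_surj (x + w).
have [tx' xu'] := xu; exists x', (y - t x'), (w - u), u; split=> //; split=> //.
  exact: adjoint_relB.
congr pair; last by lin_eq R[i].
have -> : x = x' + u - w by rewrite -E1; lin_eq R[i].
by lin_eq R[i].
Qed.

Lemma sum_norm_snd (H K : hilbertModType A) (y : K) : sum_norm (0 : H, y) = nrm y.
Proof.
rewrite /sum_norm /sum_inner /= inner_0l add0r -/(nrm _) nrm_inner.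
by rewrite sqrtr_sqr ger0_norm ?nrm_ge0.
Qed.

(* For [z.2] in the domain of [t^*] this is [graph_dec_tt]; the two components
   of the decomposition are bounded by [z], so it extends by density. *)
Lemma graph_dec_ex z : exists x y w, graph_dec z x y w.
Proof.
have [_ dense_ts _] := regt; have [v vP vz] := dense_seq dense_ts z.2.
have /choice[p pP] n : exists p : E * F * E, graph_dec (z.1, v n) p.1.1 p.1.2 p.2.
  by have [x [y [w [u [d _]]]]] := graph_dec_tt z.1 (vP n); exists (x, y, w).
have bound n m := graph_dec_bound (graph_decB (pP n) (pP m)).
have zE n m : sum_norm ((z.1, v n) - (z.1, v m)) = 1 * nrm (v n - v m).
  rewrite mul1r -(sum_norm_snd E (v n - v m)); congr sum_norm.
  by rewrite -[LHS]/(z.1 - z.1, v n - v m) subrr.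
have dom n : op_dom t (p n).1.1 by have [] := pP n.
have rel n : adjoint_rel t (p n).1.2 (p n).2 by have [] := pP n.
have [x0 xx0] : exists x0, lim_to (fun n => (p n).1.1) x0.
  by apply: (lim_to_dominated (c := 1) vz) => n m; rewrite -zE; case: (bound n m).
have [y1 yy1] : exists y1, lim_to (fun n => t (p n).1.1) y1.
  apply: (lim_to_dominated (c := 1) vz) => n m; rewrite -zE -op_appB//.
  by case: (bound n m).
have [y0 yy0] : exists y0, lim_to (fun n => (p n).1.2) y0.
  by apply: (lim_to_dominated (c := 1) vz) => n m; rewrite -zE; case: (bound n m).
have [w0 ww0] : exists w0, lim_to (fun n => (p n).2) w0.
  by apply: (lim_to_dominated (c := 1) vz) => n m; rewrite -zE; case: (bound n m).
have [tx0 y1E] := graph_lim closed_t dom xx0 yy1.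
exists x0, y0, w0; split=> //; first exact: (adjoint_rel_lim rel yy0 ww0).
rewrite [z]surjective_pairing -y1E; congr pair.
  apply/esym/(lim_to_uniq _ (lim_to_cst z.1)).
  have /(lim_toD xx0) : lim_to (fun n => - (p n).2) (- w0).
    by apply: (@lim_to_map _ _ _ -%R 1) => // [a b|a]; rewrite ?opprD// nrmN mul1r.
  by congr (lim_to _ _); apply: funext => n; have [_ _ []] := pP n.
apply: (lim_to_uniq vz); have := lim_toD yy1 yy0.
by congr (lim_to _ _); apply: funext => n; have [_ _ []] := pP n.
Qed.

Lemma graph_dec_uniq z x x' y y' w w' :
  graph_dec z x y w -> graph_dec z x' y' w' -> x = x'.
Proof.
move=> d d'; have [] := graph_dec_bound (graph_decB d d').
rewrite subrr sum_normE pn0 => x0 _ _ _.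
by apply/subr0_eq/nrm_eq0/le_anti; rewrite x0 nrm_ge0.
Qed.

Lemma graph_proj_ex : exists P, is_orth_proj (graph t) P.
Proof.
have /choice[p pP] z : exists p : E * F * E, graph_dec z p.1.1 p.1.2 p.2.
  by have [x [y [w d]]] := graph_dec_ex z; exists (x, y, w).
pose P z := ((p z).1.1, t (p z).1.1).
have dom z : op_dom t (p z).1.1 by have [] := pP z.
have orth z z' : sum_inner (P z) z' = sum_inner (P z) (P z').
  have [tx' yw' {1}->] := pP z'.
  rewrite -[X in sum_inner _ X]/(P z' + (- (p z').2, (p z').1.2)).
  rewrite -[LHS]/(@pip _ _ (sum_pre E F) _ _) pip_Dr.
  by rewrite [X in _ + X](graph_orth (dom z) yw') addr0.
exists P; split.
- move=> z z'; rewrite orth -[RHS]/(@pip _ _ (sum_pre E F) _ _) -pip_star.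
  by rewrite [X in cstar X]orth; exact/esym/(@pip_star _ _ (sum_pre E F)).
- move=> z; rewrite /P; have d := pP (P z).
  have d' : graph_dec (P z) (p z).1.1 0 0.
    by split; [exact: dom|exact: adjoint_rel0|rewrite subr0 addr0].
  by rewrite (graph_dec_uniq d d').
- apply/seteqP; split=> [_ [z _ <-]|[x y] [/= tx ->]]; first by split=> //=.
  exists (x, t x) => //; rewrite /P.
  have d' : graph_dec (x, t x) x 0 0.
    by split; [exact: tx|exact: adjoint_rel0|rewrite subr0 addr0].
  by rewrite (graph_dec_uniq (pP (x, t x)) d').
Qed.

Lemma graph_projP : is_orth_proj (graph t) (graph_proj t).
Proof. exact: xgetPex graph_proj_ex. Qed.

Lemma graph_proj_id x : op_dom t x -> graph_proj t (x, t x) = (x, t x).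
Proof.
have [_ idP rP] := graph_projP => tx.
by have [z _ <-] : range (graph_proj t) (x, t x) by rewrite rP; split.
Qed.

Lemma graph_proj_orth y w : adjoint_rel t y w -> graph_proj t (- w, y) = 0.
Proof.
have [symP idP rP] := graph_projP => yw.
apply: (@pip_injr _ _ (sum_pre E F)) => z /=; rewrite -symP.
have : range (graph_proj t) (graph_proj t z) by exists z.
rewrite rP; case: (graph_proj t z) => x y' [/= tx ->].
by rewrite graph_orth//; exact/esym/(@pip_0r _ _ (sum_pre E F)).
Qed.

Lemma graph_proj_dec z x y w : graph_dec z x y w -> graph_proj t z = (x, t x).
Proof.
have [symP idP rP] := graph_projP => -[tx yw zE].
have -> : z = (x, t x) + (- w, y) by rewrite zE.
rewrite (@proj_add _ _ (sum_pre E F) _ symP) graph_proj_id//.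
by rewrite (graph_proj_orth yw) addr0.
Qed.

End Regular.

End OperatorTheory.

(** * Gap topology *)

Section Gap.
Variables (R : realType) (A : cstarAlgType R) (E F : hilbertModType A).
Implicit Types (t s : operator E F) (c : R).

Lemma op_norm_le (T : E * F -> E * F) c : 0 <= c ->
  (forall z, sum_norm (T z) <= c * sum_norm z) -> op_norm T <= c.
Proof.
move=> c0 Tc; apply: ge_sup => [|_ [z /= z1 <-]].
  by exists (sum_norm (T 0)), 0 => //=; rewrite sum_normE pn0.
by rewrite (le_trans (Tc z))// ler_piMr.
Qed.

Lemma le_gap t s : regular E F t -> regular E F s ->
  forall z, sum_norm (graph_proj t z - graph_proj s z) <= gap t s * sum_norm z.
Proof.
move=> /graph_projP[symP idP _] /graph_projP[symQ idQ _] z.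
set P := graph_proj t in symP idP *; set Q := graph_proj s in symQ idQ *.
pose V := sum_pre E F.
have [z0|z_neq0] := eqVneq (sum_norm z) 0.
  have -> : z = 0 by exact: (@pn_eq0 _ _ V).
  rewrite (@proj0 _ _ V _ symP) (@proj0 _ _ V _ symQ) subrr.
  by rewrite !sum_normE (@pn0 _ _ V) mulr0.
have z_gt0 : 0 < sum_norm z by rewrite lt_neqAle eq_sym z_neq0 sqrtr_ge0.
pose r := (sum_norm z)^-1; have r0 : 0 <= r by rewrite invr_ge0 ltW.
pose z' : V := r%:C *: z.
have z'1 : sum_norm z' = 1.
  by rewrite sum_normE (@pnZ _ _ V) ger0_norm// -sum_normE mulVf.
have Tz' : P z' - Q z' = r%:C *: (P z - Q z).
  by rewrite (@proj_scal _ _ V _ symP) (@proj_scal _ _ V _ symQ) scalerBr.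
have : sum_norm (P z' - Q z') <= gap t s.
  apply: ub_le_sup; last by exists z' => //=; rewrite z'1.
  (* Both projections are contractions, so the supremum defining [gap] is over a set bounded by
     2. *)
  exists 2 => _ [v /= v1 <-]; rewrite sum_normE (le_trans (@pnB _ _ V _ _))//.
  have := @proj_le _ _ V _ symP idP v; have := @proj_le _ _ V _ symQ idQ v.
  by rewrite -!sum_normE; lra.
rewrite Tz' sum_normE (@pnZ _ _ V) ger0_norm// -sum_normE /r mulrC.
by rewrite ler_pdivrMr.
Qed.

(* The maps [x |-> (Q (x, t x)).1] and [y |-> ((1 - Q) (- t^* y, y)).2], with [Q]
   the projection onto the graph of [s], are at distance at most 1/2 from the
   identity, hence onto; they take values in the domains of [s] and [s^*]. *)
Lemma gap_small_bounded t s (ts : F -> E) (M : R) :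
  regular E F t -> regular E F s -> op_dom t = setT ->
  (forall x y, inner (t x) y = inner x (ts y)) -> 0 <= M ->
  (forall x, nrm (t x) <= M * nrm x) -> (forall y, nrm (ts y) <= M * nrm y) ->
  gap t s <= (2 * (1 + M))^-1 -> bounded_adjointable E F s.
Proof.
move=> regt regs tT tts M0 tM tsM ts_gap; have gapP := le_gap regt regs.
have [symQ _ rQ] := graph_projP regs.
set P := graph_proj t in gapP; set Q := graph_proj s in symQ rQ gapP.
pose V := sum_pre E F; have QD := @proj_add _ _ V _ symQ.
have domt x : op_dom t x by rewrite tT.
have half01 : 0 <= (2^-1 : R) < 1 by lra.
have M1 : 1 + M != 0 by rewrite gt_eqF// ltr_pwDl.
(* Origin of the radius: [(x, t x)] and [(- ts y, y)] have norm at most [1 + M] times that of [x] or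
   [y], so this gap leaves the factor [1/2]. *)
have bound (z : E * F) r : sum_norm z <= (1 + M) * r ->
    sum_norm (P z - Q z) <= 2^-1 * r.
  move=> zr; rewrite (le_trans (gapP z))//.
  rewrite (le_trans (ler_wpM2r (sqrtr_ge0 _) ts_gap))//.
  rewrite invfM -mulrA ler_wpM2l ?invr_ge0// ler_pdivrMl//.
  by rewrite ltr_pwDl.
have sumM (x : E) (y : F) r : nrm x + nrm y <= (1 + M) * r ->
    sum_norm (x, y) <= (1 + M) * r.
  exact/le_trans/sum_norm_le.
have sT : op_dom s = setT.
  apply/seteqP; split=> // z _.
  pose S x := x - (Q (x, t x)).1.
  have SD : {morph S : a b / a + b}.
    move=> a b; rewrite /S op_appD// -[(a + b, _)]/((a, t a) + (b, t b)) QD.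
    by rewrite /=; lin_eq R[i].
  have bS x : nrm (S x) <= 2^-1 * nrm x.
    have -> : S x = (P (x, t x) - Q (x, t x)).1 by rewrite /P graph_proj_id.
    rewrite (le_trans (nrm_fst_le _))// bound// sumM// mulrDl mul1r lerD2l.
    exact: tM.
  have [x ->] := neumann half01 SD bS z.
  have -> : x - S x = (Q (x, t x)).1 by exact: subKr.
  have : graph s (Q (x, t x)) by rewrite -rQ; exists (x, t x).
  by case.
split=> //; exists (adjoint s) => x y; apply: adjoint_domP; last by rewrite sT.
pose S y := (Q (- ts y, y)).2.
have SD : {morph S : a b / a + b}.
  move=> a b; rewrite /S.
  have -> : ts (a + b) = ts a + ts b.
    apply: (@ip_inj _ _ (hilb_space E)) => z /=.
    by rewrite -inner_star -tts inner_Dr cstarD !tts !inner_star innerDl.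
  rewrite -[(_, a + b)]/(- (ts a + ts b), a + b) opprD.
  by rewrite -[(_, a + b)]/((- ts a, a) + (- ts b, b)) QD.
have bS v : nrm (S v) <= 2^-1 * nrm v.
  have -> : S v = - (P (- ts v, v) - Q (- ts v, v)).2.
    rewrite /P (graph_proj_orth regt (bounded_rel tts _)) sub0r /=.
    by rewrite opprK.
  rewrite nrmN (le_trans (nrm_snd_le _))// bound// sumM// mulrDl mul1r nrmN.
  by rewrite addrC lerD2l.
have [v ->] := neumann half01 SD bS y.
have [x' [y' [w' d]]] := graph_dec_ex regs (- ts v, v).
rewrite /S /Q (graph_proj_dec regs d) /=; have [_ yw [_ ->]] := d.
by exists w'; rewrite addrAC subrr add0r.
Qed.

End Gap.

(** * Bounded approximants of a regular operator *)

Section Approximation.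
Variables (R : realType) (A : cstarAlgType R) (E F : hilbertModType A).
Variables (t : operator E F).
Hypothesis regt : regular E F t.

(* [1 + e t^* t = (1 - (1 - e) K) (1 + t^* t)], where [K = 1 - (1 + t^* t)^-1] is
   a contraction. *)
Lemma regular_surj_scale (e : R) : 0 < e <= 1 ->
  forall z, exists p : E * E, tt_rel t p.1 p.2 /\ z = p.1 + e%:C *: p.2.
Proof.
move=> /andP[e0 e1] z.
have /choice[p pP] v : exists p : E * E, tt_rel t p.1 p.2 /\ v = p.1 + p.2.
  by have [x [u [xu vE]]] := regular_surj regt v; exists (x, u).
pose K v := (p v).2.
have symK : @sym _ _ (hilb_space E) K.
  move=> a b /=; have [[ta au] aE] := pP a; have [[tb bu] bE] := pP b.
  rewrite [in LHS]bE [in RHS]aE inner_Dr innerDl; congr (_ + _).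
  by rewrite -inner_star -au// inner_star bu.
have bK : @bnd _ _ (hilb_space E) (fun v => (1 - e)%:C *: K v) (1 - e).
  rewrite -[X in bnd _ X]mulr1; apply: bndZ; first by lra.
  move=> v; rewrite mul1r; have [xu vE] := pP v.
  by have [_ + _] := tt_rel_bound ler01 xu; rewrite rmorph1 !scale1r -vE.
have [|w ->] := @neumann R (hilb_space E) _ (1 - e) _ (adj_add (adjZ (1 - e) symK)) bK z.
  by lra.
exists (p w); have [xu wE] := pP w; split=> //.
by rewrite [X in X - _]wE /K rmorphB rmorph1; lin_eq R[i].
Qed.

Variable e : R.
Hypothesis e01 : 0 < e <= 1.
Let e_gt0 : 0 < e. Proof. by case/andP: e01. Qed.
Let e_ge0 : 0 <= e. Proof. exact: ltW. Qed.

(* [D = (1 + e t^* t)^-1], [dD = t^* t D], and below [C] is the square root of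
   [D]; the approximant of [t] is [t C]. *)
Variables D dD : E -> E.
Hypotheses (DtD : forall z, tt_rel t (D z) (dD z))
  (DE : forall z, z = D z + e%:C *: dD z).

Let domD z : op_dom t (D z). Proof. by case: (DtD z). Qed.

Lemma resolvent_uniq x u : tt_rel t x u -> D (x + e%:C *: u) = x.
Proof.
move=> xu; set z := x + _; apply/esym/subr0_eq/nrm_eq0/le_anti.
rewrite nrm_ge0 andbT; have [le_d _ _] := tt_rel_bound e_ge0 (tt_relB xu (DtD z)).
rewrite (le_trans le_d)// scalerBr.
have -> : x - D z + (e%:C *: u - e%:C *: dD z) = z - (D z + e%:C *: dD z).
  by rewrite /z; lin_eq R[i].
by rewrite -DE subrr nrm0.
Qed.

Lemma resolvent_sym : @sym _ _ (hilb_space E) D.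
Proof.
move=> a b /=; have [ta au] := DtD a; have [tb bu] := DtD b.
rewrite [in LHS](DE b) [in RHS](DE a) inner_Dr innerDl; congr (_ + _).
by rewrite inner_Zr innerZl -bu// -(inner_star (D b) (dD a)) -au// inner_star.
Qed.

(** The contraction hypothesis of [sqrt_ex] for [T = 1 - D], whose root is [C]. *)
Lemma resolvent_bnd : @bnd _ _ (hilb_space E) (fun z => z - D z) 1.
Proof.
move=> z; rewrite mul1r; have [_ + _] := tt_rel_bound e_ge0 (DtD z).
by rewrite -DE; congr (nrm _ <= _); rewrite {2}(DE z); lin_eq R[i].
Qed.

Variable C : E -> E.
Hypotheses (symC : @sym _ _ (hilb_space E) C) (CC : forall z, C (C z) = D z)
  (C1 : @bnd _ _ (hilb_space E) (fun z => z - C z) 1).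

Let CD x y : C (x + y) = C x + C y. Proof. exact: (adj_add symC). Qed.
Let CB x y : C (x - y) = C x - C y. Proof. exact: (adj_sub symC). Qed.

Lemma root_range x u : tt_rel t x u -> exists y, x = C (C y).
Proof.
by move=> xu; exists (x + e%:C *: u); rewrite CC (resolvent_uniq xu).
Qed.

(** The range of [C] contains the domain of [t^* t], which is dense: for [y] in the domain of [t^*]
    near [t x], the projection of [(x, y)] to the graph lies over that domain and is close to
    [(x, t x)]. *)
Lemma root_dense : dense (range C : set E).
Proof.
apply: approx_dense => z d d0; have d2 : 0 < d / 2 by lra.
have [x tx zx] := dense_approx (@op_dom_dense _ _ _ _ t) z d2.
have [_ dense_ts _] := regt.
have [y ty xy] := dense_approx dense_ts (t x) d2.
have [x' [y' [w' [u [d' xu]]]]] := graph_dec_tt regt x ty.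
have [v x'E] := root_range xu; exists x'; first by exists (C v).
have dx : graph_dec t (x, t x) x 0 0.
  by split; [exact: tx|exact: adjoint_rel0|rewrite subr0 addr0].
have [+ _ _ _] := graph_dec_bound (graph_decB dx d').
rewrite -[(x, t x) - (x, y)]/(x - x, t x - y) subrr sum_norm_snd.
by have := nrm_dist3 z x x'; lra.
Qed.

Lemma root_bnd : @bnd _ _ (hilb_space E) C 1.
Proof.
apply: (bnd_cstar symC) => // z /=; rewrite CC expr1n mul1r.
have [le_d _ _] := tt_rel_bound e_ge0 (DtD z); by rewrite {2}(DE z).
Qed.

(* [e <t D y, t D y> = <D y, y - D y> = <x, x> - <C x, C x>] for [x = C y]. *)
Lemma root_energy y :
  e%:C *: inner (t (C (C y))) (t (C (C y))) =
  inner (C y) (C y) - inner (C (C y)) (C (C y)).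
Proof.
rewrite CC; have [ty yu] := DtD y; rewrite yu// -inner_Zr.
have -> : e%:C *: dD y = y - D y by rewrite {2}(DE y); lin_eq R[i].
rewrite inner_Dr inner_Nr; congr (_ - _).
by have := symC (C y) y => /= <-; rewrite CC.
Qed.

(* [C (1 - C) = C (1 - C) C + (1 - C) C (1 - C)]. *)
Lemma root_positive x : cpos (inner (C x) x - inner (C x) (C x)).
Proof.
have sC : spos (C : hilb_space E -> hilb_space E).
  by split=> //; exists 1 => // z; rewrite rmorph1 scale1r.
have sC' : spos (fun z : hilb_space E => z - C z).
  split; first by apply: adjB.
  exists 1 => // z; rewrite rmorph1 scale1r.
  by have := root_bnd z; congr (nrm _ <= _); lin_eq R[i].
have pos_inner (p : hilb_space E -> hilb_space E) z : spos p -> cpos (inner (p z) z).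
  move=> /spos_root[k [[symk _] kk _]]; rewrite -kk.
  by have := symk (k z) z => /= ->; exact: inner_cpos.
have -> : inner (C x) x - inner (C x) (C x) =
    inner (C x - C (C x)) (C x) + inner (C (x - C x)) (x - C x).
  have E1 : inner (C (C x)) x = inner (C x) (C x) by exact: (symC (C x) x).
  rewrite CB !(innerDl, inner_Nl, inner_Dr, inner_Nr) E1; lin_eq R[i].
by apply: cposD; [exact: (pos_inner _ _ sC')|exact: (pos_inner _ _ sC)].
Qed.

Let k := Num.sqrt e.
Let k_gt0 : 0 < k. Proof. by rewrite sqrtr_gt0. Qed.
Let k_ge0 : 0 <= k. Proof. exact: ltW. Qed.
Let k2 : k ^+ 2 = e. Proof. exact: sqr_sqrtr. Qed.

(** Restricted to the range of [C] because only [C (C y) = D y] is known so far to lie in the domain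
    of [t]. *)
Lemma root_op_range_bound y : k * nrm (t (C (C y))) <= nrm (C y).
Proof.
rewrite -(@ler_pXn2r _ 2)// ?nnegrE ?mulr_ge0 ?nrm_ge0// exprMn k2 -!nrm_inner.
rewrite -nrmZp// root_energy.
have := @cpos_le _ _ (inner (C y) (C y) - inner (C (C y)) (C (C y)))
  (inner (C (C y)) (C (C y))).
rewrite subrK; apply; last exact: inner_cpos.
by rewrite -root_energy; apply: cposZ => //; exact: inner_cpos.
Qed.

(** [1 - C^2 = (1 - C)^2 + 2 (C - C^2)] with [C - C^2] positive, so [(1 - C)^2] is dominated by the
    energy. *)
Lemma root_op_range_lower y : nrm (C y - C (C y)) <= k * nrm (t (C (C y))).
Proof.
rewrite -(@ler_pXn2r _ 2)// ?nnegrE ?mulr_ge0 ?nrm_ge0// exprMn k2 -!nrm_inner.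
rewrite -nrmZp// root_energy; set x := C y.
have E1 : inner (C x) x = inner x (C x) by exact: (symC x x).
have -> : inner x x - inner (C x) (C x) = inner (x - C x) (x - C x) +
    (2 : R)%:C *: (inner (C x) x - inner (C x) (C x)).
  rewrite !(innerDl, inner_Nl, inner_Dr, inner_Nr) E1 rmorphD rmorph1; lin_eq R[i].
apply: cpos_le; first exact: inner_cpos.
by apply: cposZ => //; exact: root_positive.
Qed.

(** For [w n] in the range of [C] tending to [x], the [t (C (w n))] are Cauchy, and closedness of
    [t] puts [C x] in its domain. *)
Lemma root_op_bound x : op_dom t (C x) /\ k * nrm (t (C x)) <= nrm x.
Proof.
have [w wP wx] := dense_seq root_dense x.
have dom n : op_dom t (C (w n)) by have [y _ <-] := wP n; rewrite CC.
have [y0 yy0] : exists y0, lim_to (fun n => t (C (w n))) y0.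
  apply: (lim_to_dominated (c := k^-1) wx) => n m.
  rewrite -op_appB// ler_pdivlMl// -CB.
  by have [a _ <-] := wP n; have [b _ <-] := wP m; rewrite -CB; exact: root_op_range_bound.
have Cwx : lim_to (fun n => C (w n)) (C x).
  exact: (@lim_to_map _ _ _ (C : E -> E) 1 _ _ CD root_bnd wx).
have [closed_t _ _] := regt.
have [tCx y0E] := graph_lim closed_t dom Cwx yy0; split=> //; rewrite -y0E.
apply/ler_addgt0Pl => d d0; have d2 : 0 < d / 2 by lra.
have [N wN] := wx _ d2; have [M yM] := yy0 _ (divr_gt0 d2 k_gt0).
have := wN _ (leq_addr M N); have := yM _ (leq_addl N M).
set n := (N + M)%N; rewrite ler_pdivlMr// mulrC.
have := nrmB (t (C (w n))) (t (C (w n)) - y0).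
rewrite opprB addrC subrK; have := nrmD (w n - x) x; rewrite subrK.
have : k * nrm (t (C (w n))) <= nrm (w n).
  by have [y _ <-] := wP n; exact: root_op_range_bound.
by move=> + + /(ler_wpM2l k_ge0); rewrite mulrDr; lra.
Qed.

Lemma root_op_lower x : nrm (x - C x) <= k * nrm (t (C x)).
Proof.
have domC y : op_dom t (C y) by case: (root_op_bound y).
apply/ler_addgt0Pl => d d0; have d2 : 0 < d / 2 by lra.
have [_ [y _ <-] xy] := dense_approx root_dense x d2.
have := root_op_range_lower y.
have := nrm_dist3 (x - C x) (C y - C (C y)) 0; rewrite !subr0.
have -> : x - C x - (C y - C (C y)) = x - C y - C (x - C y) by rewrite CB; lin_eq R[i].
have := C1 (x - C y); rewrite mul1r.
have [_ ] := root_op_bound (x - C y); rewrite CB op_appB//.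
have := nrmB (t (C x)) (t (C x) - t (C (C y))).
rewrite subKr => /(ler_wpM2l k_ge0); rewrite mulrDr; lra.
Qed.

Lemma root_act a x : C (act a x) = act a (C x).
Proof.
apply: (@ip_inj _ _ (hilb_space E)) => z /=; have := symC (act a x) z => /= ->.
by rewrite !inner_act; have := symC x z => /= ->.
Qed.

(** On the domain of [t^*] the adjoint is [C t^*]; it is bounded by [1 / k] there and extends to [F]
    by density. *)
Lemma root_op_adjoint : exists ss : F -> E, forall x y, inner (t (C x)) y = inner x (ss y).
Proof.
suff /choice[ss ssP] y : exists z, forall x, inner (t (C x)) y = inner x z.
  by exists ss => x y; rewrite ssP.
have domC x : op_dom t (C x) by case: (root_op_bound x).
have [_ dense_ts _] := regt; have [v vP vy] := dense_seq dense_ts y.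
have relC n x : inner (t (C x)) (v n) = inner x (C (adjoint t (v n))).
  by rewrite (adjoint_domP (vP n))//; exact: (symC x _).
have [z zz] : exists z, lim_to (fun n => C (adjoint t (v n))) z.
  apply: (lim_to_dominated (c := k^-1) vy) => n m; rewrite ler_pdivlMl//.
  set d := C _ - C _.
  have dE : inner d d = inner (t (C d)) (v n - v m).
    by rewrite inner_Dr inner_Nr !relC {2}/d inner_Dr inner_Nr.
  have [d0|d_neq0] := eqVneq (nrm d) 0; first by rewrite d0 mulr0 nrm_ge0.
  have d_gt0 : 0 < nrm d by rewrite lt_neqAle eq_sym d_neq0 nrm_ge0.
  rewrite -(ler_pM2r d_gt0) -mulrA -expr2 -nrm_inner dE.
  rewrite (le_trans (ler_wpM2l k_ge0 (inner_cs _ _)))// mulrA mulrC.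
  by rewrite ler_wpM2l ?nrm_ge0//; case: (root_op_bound d).
exists z => x; apply: (@lim_to_uniq _ _ (fun n => inner (t (C x)) (v n))).
  apply: (@lim_to_map _ _ _ (fun u : F => inner (t (C x)) u) (nrm (t (C x)))) => // [a b|a].
    exact: inner_Dr.
  exact: inner_cs.
have -> : (fun n => inner (t (C x)) (v n)) = (fun n => inner x (C (adjoint t (v n)))).
  by apply: funext => n; rewrite relC.
apply: (@lim_to_map _ _ _ (fun u : E => inner x u) (nrm x)) => // [a b|a].
  exact: inner_Dr.
exact: inner_cs.
Qed.

Lemma setT_dense : dense (setT : set E).
Proof. by apply: approx_dense => x d d0; exists x; rewrite // subrr nrm0 ltW. Qed.

Let domC x : op_dom t (C x). Proof. by case: (root_op_bound x). Qed.

Let root_opD x y : setT x -> setT y -> t (C (x + y)) = t (C x) + t (C y).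
Proof. by move=> _ _; rewrite CD op_appD. Qed.

Let root_opZ (a : R[i]) x : setT x -> t (C (a *: x)) = a *: t (C x).
Proof. by move=> _; rewrite (adj_scale symC) op_appZ. Qed.

Let root_op_act a x : setT x -> t (C (act a x)) = act a (t (C x)).
Proof. by move=> _; rewrite root_act op_app_act. Qed.

Let root_op_out x : ~ setT x -> t (C x) = 0.
Proof. by move=> /(_ I). Qed.

Definition root_op : operator E F :=
  @Operator R A E F setT (fun x => t (C x)) I (fun _ _ _ _ => I)
    (fun _ _ _ => I) (fun _ _ _ => I) setT_dense root_opD root_opZ root_op_act
    root_op_out.

Lemma root_op_bounded : bounded_adjointable E F root_op.
Proof. by split=> //; have [ss ssP] := root_op_adjoint; exists ss. Qed.

(* The point [(C x, t C x)] of the graph of [t] and the point [(x, t C x)] of the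
   graph of [root_op] are close, and the former are dense in the graph of [t]. *)
Lemma root_op_gap : gap t root_op <= k + k.
Proof.
have regs : regular E F root_op.
  by have [sT [ss ssP]] := root_op_bounded; exact: (bounded_regular sT ssP).
have [symP idP rP] := graph_projP regt; have [symQ idQ rQ] := graph_projP regs.
set P := graph_proj t in symP idP rP; set Q := graph_proj root_op in symQ idQ rQ.
pose V := sum_pre E F.
have near_graph x : sum_norm ((C x, t (C x)) - (x, t (C x))) <= k * nrm (t (C x)).
  rewrite (le_trans (sum_norm_le _))//= subrr nrm0 addr0 nrmC.
  exact: root_op_lower.
(* [1 - Q] is a contraction and kills [(x, t (C x))], so [P z - Q (P z)] is no longer than
   [P z - (x, t (C x))]. *)
have QP_tt z : (exists x, P z = (C x, t (C x))) ->
    sum_norm (P z - Q (P z)) <= k * sum_norm z.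
  move=> [x PzE].
  have Qw : Q (x, t (C x)) = (x, t (C x)) by exact: (graph_proj_id regs).
  have -> : P z - Q (P z) = (P z - (x, t (C x))) - Q (P z - (x, t (C x))).
    rewrite (@proj_add _ _ V _ symQ) (@proj_opp _ _ V _ symQ) Qw.
    by rewrite opprB addrA subrK.
  rewrite (le_trans (@projC_le _ _ V _ symQ idQ _))// -sum_normE PzE.
  rewrite (le_trans (near_graph x))// ler_wpM2l//.
  rewrite (le_trans (nrm_snd_le (C x, t (C x))))// -PzE.
  exact: (@proj_le _ _ V _ symP idP).
apply: op_norm_le; first exact: addr_ge0.
apply: (@proj_gap _ _ V) => // z; rewrite -!sum_normE.
(* [P z] need not have the form required by [QP_tt], but [P z'] does when [z'.2] is in the domain of
   [t^*]. The tolerance [d / (k + 1)] enters once with factor [k] and once with factor 1. *)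
- apply/ler_addgt0Pl => d d0.
  have k1 : 0 < k + 1 by rewrite ltr_wpDl.
  have [_ dense_ts _] := regt.
  have [y ty zy] := dense_approx dense_ts z.2 (divr_gt0 d0 k1).
  pose z' := (z.1, y).
  have [x' [y' [w' [u [d' xu]]]]] := graph_dec_tt regt z.1 ty.
  have [v x'E] := root_range xu.
  have /QP_tt : exists x, P z' = (C x, t (C x)).
    by exists (C v); rewrite -x'E; exact: (graph_proj_dec regt d').
  have zz' : sum_norm (z - z') <= d / (k + 1).
    by rewrite (le_trans (sum_norm_le _))//= subrr nrm0 add0r.
  have z'z : sum_norm z' <= sum_norm z + d / (k + 1).
    have := @pnB _ _ V z (z - z'); rewrite -!sum_normE.
    by rewrite opprB addrC subrK; lra.
  have := @pnD _ _ V (P z' - Q (P z')) ((P (z - z')) - Q (P (z - z'))).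
  have -> : (P z' - Q (P z') + (P (z - z') - Q (P (z - z'))) : V) = P z - Q (P z).
    rewrite !(@proj_add _ _ V _ symP, @proj_opp _ _ V _ symP).
    rewrite !(@proj_add _ _ V _ symQ, @proj_opp _ _ V _ symQ); lin_eq R[i].
  rewrite -!sum_normE.
  have := @projC_le _ _ V _ symQ idQ (P (z - z')); rewrite -!sum_normE.
  have := @proj_le _ _ V _ symP idP (z - z'); rewrite -!sum_normE.
  have dE : d = k * (d / (k + 1)) + d / (k + 1) by field; rewrite gt_eqF.
  by have := ler_wpM2l k_ge0 z'z; rewrite mulrDr; lra.
(* No approximation here: every point of the graph of [root_op] is some [(x, t (C x))]. *)
- have : range Q (Q z) by exists z.
  rewrite rQ => -[_ Qz2]; set x := (Q z).1 in Qz2.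
  have QzE : Q z = (x, t (C x)) by rewrite [LHS]surjective_pairing Qz2.
  have Pw : P (C x, t (C x)) = (C x, t (C x)) by exact: (graph_proj_id regt).
  have -> : Q z - P (Q z) = (Q z - (C x, t (C x))) - P (Q z - (C x, t (C x))).
    rewrite (@proj_add _ _ V _ symP) (@proj_opp _ _ V _ symP) Pw.
    by rewrite opprB addrA subrK.
  rewrite (le_trans (@projC_le _ _ V _ symP idP _))// -sum_normE QzE.
  rewrite -opprB sum_normE (@pnN _ _ V) -sum_normE.
  rewrite (le_trans (near_graph x))// ler_wpM2l//.
  rewrite (le_trans (nrm_snd_le (x, t (C x))))// -QzE.
  exact: (@proj_le _ _ V _ symQ idQ).
Qed.

End Approximation.

Section Density.
Variables (R : realType) (A : cstarAlgType R) (E F : hilbertModType A).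

Lemma regular_approx (t : operator E F) (c : R) : regular E F t -> 0 < c ->
  exists2 s, bounded_adjointable E F s & gap t s < c.
Proof.
(* The gap is at most [2 sqrt e = 2 d <= 2 c / 3 < c]; the minimum with 1 ensures [e <= 1], as
   [regular_surj_scale] requires. *)
move=> regt c0; pose d := Num.min 1 (c / 3); pose e := d ^+ 2.
have d0 : 0 < d by rewrite lt_min ltr01 divr_gt0.
have d1 : d <= 1 by rewrite ge_min lexx.
have dc : d <= c / 3 by rewrite ge_min lexx orbT.
have e01 : 0 < e <= 1 by rewrite exprn_gt0//= expr_le1// ltW.
have /choice[p pP] := regular_surj_scale regt e01.
have DtD z : tt_rel t (p z).1 (p z).2 by case: (pP z).
have DE z : z = (p z).1 + e%:C *: (p z).2 by case: (pP z).
have symD := resolvent_sym DtD DE.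
have [C [symC CC C1 _]] := @sqrt_ex _ _ (hilb_space E) (fun z => z - (p z).1)
  (adjB (@adj_id _ _ (hilb_space E)) symD) (resolvent_bnd e01 DtD DE).
have CD z : C (C z) = (p z).1 by rewrite CC subKr.
exists (root_op regt e01 DtD DE symC CD); first exact: root_op_bounded.
rewrite (le_lt_trans (root_op_gap _ _ _ _ _ _ _))// sqrtr_sqr ger0_norm ?ltW//.
by rewrite (le_lt_trans (lerD dc dc))//; lra.
Qed.

End Density.

Theorem theorem3p4 (R : realType) (A : cstarAlgType R)
    (E F : hilbertModType A) :
  [/\ bounded_adjointable E F `<=` regular E F,
      open ([set t | bounded_adjointable E F (regular_val t)]
              : set (regular_op E F)) &
      dense ([set t | bounded_adjointable E F (regular_val t)]
              : set (regular_op E F))].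
Proof.
split.
- by move=> t [tT [ts tts]]; exact: (bounded_regular tT tts).
- move=> t /= [tT [ts tts]]; have [M M0 [tM tsM]] := bounded_bound tts.
  have M1 : 0 < (2 * (1 + M))^-1 by rewrite invr_gt0 mulr_gt0// ltr_pwDl.
  exists (2 * (1 + M))^-1 => // s /ltW; apply: gap_small_bounded tT tts M0 tM tsM.
    exact: regular_valP.
  exact: regular_valP.
- move=> O [t Ot] oO; have [e e0 eO] := oO _ Ot.
  have [s bs ts_e] := regular_approx (regular_valP t) e0.
  have regs : regular E F s.
    by case: bs => sT [ss sss]; exact: (bounded_regular sT sss).
  by exists (RegularOp regs); split=> //; exact: eO.
Qed.
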